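(* Let $Z_1, Z_2, \ldots$ be independent, identically distributed random vectors in $\mathbb{R}^2$ with $\mathbb{E}[\|Z_1\|^2] < \infty$ and $\|\mathbb{E}[Z_1]\| \neq 0$. Let $S_0 := 0$ and $S_n := \sum_{i=1}^n Z_i$ for $n \geq 1$, and let $L_n$ denote the length of the perimeter of the convex hull of $\{S_0, S_1, \ldots, S_n\}$. Then, as $n \to \infty$, \[ n^{-1/2} \left| L_n - \mathbb{E}[L_n] - \sum_{i=1}^n \frac{2 (Z_i - \mathbb{E}[Z_1]) \cdot \mathbb{E}[Z_1]}{\|\mathbb{E}[Z_1]\|} \right| \to 0 \quad \text{in } L^2. \]
   Context: $\cdot$ denotes the Euclidean inner product and $\|\cdot\|$ the Euclidean norm on $\mathbb{R}^2$. *)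

(* Defs.v *)
From HB Require Import structures.
From mathcomp Require Import all_boot all_order all_algebra.
From mathcomp Require Import all_classical all_reals all_analysis.
Set Implicit Arguments. Unset Strict Implicit. Unset Printing Implicit Defensive.
Import Order.TTheory GRing.Theory Num.Theory.
Local Open Scope ring_scope.
Local Open Scope classical_set_scope.

Section Plane.
Variable R : realType.
Definition dot2 (u v : R * R) : R := u.1 * v.1 + u.2 * v.2.
Definition norm2 (u : R * R) : R := Num.sqrt (dot2 u u).
Definition add2 (u v : R * R) : R * R := (u.1 + v.1, u.2 + v.2).
Definition sub2 (u v : R * R) : R * R := (u.1 - v.1, u.2 - v.2).
Definition scale2 (a : R) (u : R * R) : R * R := (a * u.1, a * u.2).
Definition cross2 (u v : R * R) : R := u.1 * v.2 - u.2 * v.1.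

Definition in_open_seg (p q r : R * R) : Prop :=
  exists2 t : R, 0 < t < 1 & r = add2 p (scale2 t (sub2 q p)).

(* (p, q) is a counterclockwise-oriented edge of the boundary of the convex
   hull of the finite point set s: p <> q are in s, every point of s lies
   weakly to the left of the directed line p -> q, and no point of s lies in
   the open segment ]p, q[ (so collinear points on a side split it). *)
Definition hull_edge (s : seq (R * R)) (p q : R * R) : bool :=
  [&& p \in s, q \in s, p != q,
      `[< forall r, r \in s -> 0 <= cross2 (sub2 q p) (sub2 r p) >] &
      `[< forall r, r \in s -> ~ in_open_seg p q r >]].

(* Perimeter length of the convex hull of the finite set s: the total length
   of its counterclockwise boundary edges.  For collinear s this is twice the
   length of the segment, for a singleton it is 0. *)
Definition hull_perimeter (s : seq (R * R)) : R :=
  \sum_(p <- undup s) \sum_(q <- undup s | hull_edge s p q) norm2 (sub2 q p).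
End Plane.

Definition independent_rvecs {d} {T : measurableType d} {R : realType}
    (P : probability T R) (Z : nat -> T -> R * R) : Prop :=
  forall (s : seq nat) (A : nat -> set (R * R)),
    uniq s -> (forall i, measurable (A i)) ->
    P (\big[setI/setT]_(i <- s) (Z i @^-1` A i)) =
    (\prod_(i <- s) P (Z i @^-1` A i))%E.

Definition identically_distributed {d} {T : measurableType d} {R : realType}
    (P : probability T R) (Z : nat -> T -> R * R) : Prop :=
  forall i (A : set (R * R)), measurable A ->
    P (Z i @^-1` A) = P (Z 0%N @^-1` A).

(* Mean vector of a random vector (meaningful when integrable). *)
Definition mean2 {d} {T : measurableType d} {R : realType}
    (P : probability T R) (X : T -> R * R) : R * R :=
  (fine (\int[P]_x ((X x).1)%:E), fine (\int[P]_x ((X x).2)%:E)).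

(* Random walk S_n = Z_1 + ... + Z_n, with Z_k := Z (k-1), S_0 = 0. *)
Definition walk {T : Type} {R : realType} (Z : nat -> T -> R * R) (n : nat)
    (x : T) : R * R :=
  \big[@add2 R/(0, 0)]_(i < n) Z i x.

Definition hull_len {T : Type} {R : realType} (Z : nat -> T -> R * R) (n : nat)
    (x : T) : R :=
  hull_perimeter [seq walk Z k x | k <- iota 0 n.+1].

(* Main.v *)
(** The statistic [2 * S_n.u], with [u] the unit vector along the mean step,
    already approximates [L_n] without centring: [D_n := L_n - 2 * S_n.u] is
    nonnegative and [E (D_n ^ 2) = o(n)].

    A generic line orthogonal to [e] is crossed by exactly one hull edge in each
    direction, so the projections of the hull edges on [e] have total length twice
    the width of the walk along [e].  As [|v.u| <= |v|], this gives [0 <= D_n].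
    Conversely [|v|] is at most a hexagonal norm built from [v.u] and
    [v.(t u + u')], [v.(t u - u')] with [u'] orthogonal to [u], so [D_n] is at most
    [2 t^2 |S_n.u|] plus the overshoots of the walk beyond its two endpoints in
    these three directions, in all of which the walk has positive drift.

    An overshoot is the sum of two Lindley processes [w |-> max (w - x) 0], run on
    the steps in their natural order and in reverse.  A potential
    [max (w - A) 0 ^ 2 + k * w ^ 2], with [A] a small multiple of [sqrt n], shows
    that their second moments are [o(n)], even when the drift is only of order
    [t = eta / n^(1/4)]; for that [t] the term [2 t^2 |S_n.u|] is also small
    compared with [sqrt n]. *)
Require Import Defs.
From HB Require Import structures.
From mathcomp Require Import all_boot all_order all_algebra.
From mathcomp Require Import all_classical all_reals all_analysis.
From mathcomp Require Import measurable_realfun ring lra.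
Set Implicit Arguments. Unset Strict Implicit. Unset Printing Implicit Defensive.
Import Order.TTheory GRing.Theory Num.Theory.
Local Open Scope ring_scope.
Local Open Scope classical_set_scope.

(** * Edges and perimeter of a planar convex hull *)

Lemma seq_argmin {T : eqType} {R : realDomainType} (f : T -> R) (l : seq T) x0 :
  x0 \in l -> exists2 x, x \in l & forall y, y \in l -> f x <= f y.
Proof.
elim: l x0 => // z l IH x0 _.
case: l IH => [_|w l IH].
  by exists z; rewrite ?mem_head// => y; rewrite inE => /eqP->.
have [x xl xmin] := IH w (mem_head _ _).
have [zx|xz] := leP (f z) (f x).
  exists z; rewrite ?mem_head// => y; rewrite inE => /predU1P[->//|/xmin].
  exact: le_trans.
exists x; rewrite ?(in_cons z) ?xl ?orbT// => y; rewrite inE => /predU1P[->|/xmin//].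
exact: ltW.
Qed.

Lemma gap_decomposition {R : realFieldType} (V : seq R) : exists g : seq (R * R),
  (forall x, x \in g -> x.1 \notin V) /\
  forall a b, a \in V -> b \in V -> a <= b ->
    b - a = \sum_(x <- g | a < x.1 < b) x.2.
Proof.
pose v := sort <=%O (undup V).
have vV x : (x \in v) = (x \in V) by rewrite mem_sort mem_undup.
have v_lt : sorted <%O v by rewrite sort_lt_sorted undup_uniq.
have nth_lt i j : (i < size v)%N -> (j < size v)%N ->
    (v`_i < v`_j) = (i < j)%N.
  by move=> iv jv; rewrite (lt_sorted_ltn_nth 0 v_lt).
pose mid j := (v`_j + v`_j.+1) / 2.
have lt_mid i j : (i < size v)%N -> (j.+1 < size v)%N ->
    (v`_i < mid j) = (i <= j)%N.
  move=> iv jv; have jj : v`_j < v`_j.+1 by rewrite nth_lt// ltnW.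
  have [ij|ji] := leqP i j.
    have : v`_i <= v`_j by rewrite leNgt nth_lt ?(ltnW jv)// -leqNgt.
    by rewrite /mid => ?; lra.
  have : v`_j.+1 <= v`_i by rewrite leNgt nth_lt// -leqNgt.
  by rewrite /mid => ?; apply/negbTE; lra.
have mid_lt i j : (i < size v)%N -> (j.+1 < size v)%N ->
    (mid j < v`_i) = (j < i)%N.
  move=> iv jv; have jj : v`_j < v`_j.+1 by rewrite nth_lt// ltnW.
  have [ij|ji] := ltnP j i.
    have : v`_j.+1 <= v`_i by rewrite leNgt nth_lt// -leqNgt.
    by rewrite /mid => ?; lra.
  have : v`_i <= v`_j by rewrite leNgt nth_lt ?(ltnW jv)// -leqNgt.
  by rewrite /mid => ?; apply/negbTE; lra.
exists [seq (mid j, v`_j.+1 - v`_j) | j <- index_iota 0 (size v).-1]; split.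
  move=> x /mapP[j + ->]; rewrite mem_index_iota /= ltn_predRL => jv.
  rewrite -vV; apply/negP => /(nthP 0)[i iv /eqP]; rewrite eq_le => /andP[].
  by rewrite !leNgt lt_mid// mid_lt// -leqNgt; case: leqP.
move=> a b; rewrite -!vV => /(nthP 0)[i iv <-] /(nthP 0)[k kv <-].
rewrite leNgt nth_lt// -leqNgt => ik.
rewrite big_map /= -(telescope_sumr (fun j => v`_j) ik).
have kv' : (k <= (size v).-1)%N by case: (size v) kv.
rewrite (big_nat_widen _ _ _ _ _ kv') (big_nat_widenl _ _ _ _ _ (leq0n i)) /=.
rewrite [LHS]big_seq_cond [RHS]big_seq_cond; apply: eq_bigl => j.
rewrite mem_index_iota /= ltn_predRL.
by case: ltnP => //= jv; rewrite lt_mid// mid_lt// andbC.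
Qed.

Section CrossingEdges.
Context {R : realType}.
Implicit Types (s : seq (R * R)) (e p q r : R * R) (h : R).

Lemma cross2_frame e p q r :
  cross2 (sub2 q p) (sub2 r p) * dot2 e e =
  (dot2 q e - dot2 p e) * (cross2 e r - cross2 e p) -
  (cross2 e q - cross2 e p) * (dot2 r e - dot2 p e).
Proof. by rewrite /cross2 /sub2 /dot2 /=; ring. Qed.

Lemma frame_inj e p q : 0 < dot2 e e ->
  dot2 p e = dot2 q e -> cross2 e p = cross2 e q -> p = q.
Proof.
move=> e0 xpq ypq; have eN0 := lt0r_neq0 e0.
case: p q xpq ypq => [p1 p2] [q1 q2] xpq ypq; congr pair; apply: (mulIf eN0).
  transitivity (dot2 (p1, p2) e * e.1 - cross2 e (p1, p2) * e.2).
    by rewrite /cross2 /dot2 /=; ring.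
  by rewrite xpq ypq /cross2 /dot2 /=; ring.
transitivity (dot2 (p1, p2) e * e.2 + cross2 e (p1, p2) * e.1).
  by rewrite /cross2 /dot2 /=; ring.
by rewrite xpq ypq /cross2 /dot2 /=; ring.
Qed.

Lemma dot2_gt0 e p q : dot2 p e < dot2 q e -> 0 < dot2 e e.
Proof.
case: e p q => [e1 e2] [p1 p2] [q1 q2]; rewrite /dot2/= => pq.
rewrite -!expr2 lt_neqAle addr_ge0 ?sqr_ge0// andbT eq_sym paddr_eq0 ?sqr_ge0//.
rewrite !sqrf_eq0; apply: contraTN pq => /andP[/eqP-> /eqP->].
by rewrite !mulr0 !addr0 ltxx.
Qed.

Lemma frame_open_seg e p q r : 0 < dot2 e e ->
  dot2 p e < dot2 r e < dot2 q e ->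
  (dot2 q e - dot2 p e) * (cross2 e r - cross2 e p) =
  (cross2 e q - cross2 e p) * (dot2 r e - dot2 p e) ->
  in_open_seg p q r.
Proof.
move=> e0 /andP[pr rq] coll.
have pq : 0 < dot2 q e - dot2 p e by lra.
exists ((dot2 r e - dot2 p e) / (dot2 q e - dot2 p e)).
  apply/andP; split; first by rewrite divr_gt0// subr_gt0.
  by rewrite ltr_pdivrMr// mul1r; lra.
apply: (frame_inj e0); set t := (_ / _).
  transitivity (dot2 p e + t * (dot2 q e - dot2 p e)).
    by rewrite /t divfK ?lt0r_neq0//; ring.
  by rewrite /dot2 /=; ring.
transitivity (cross2 e p + t * (cross2 e q - cross2 e p)).
  suff -> : t * (cross2 e q - cross2 e p) = cross2 e r - cross2 e p by ring.
  by rewrite /t mulrAC [_ * (cross2 e q - _)]mulrC -coll mulrC mulKf ?lt0r_neq0.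
by rewrite /cross2 /=; ring.
Qed.

(* Height, in the frame whose first axis is [e], at which the line through [p]
   and [q] meets the line [dot2 _ e = h]. *)
Let height e h p q := (cross2 e p * (dot2 q e - h) + cross2 e q * (h - dot2 p e))
  / (dot2 q e - dot2 p e).

Lemma crossing_edge_exists s e h a b : a \in s -> b \in s ->
  dot2 a e < h < dot2 b e -> (forall r, r \in s -> dot2 r e != h) ->
  exists p q, hull_edge s p q /\ dot2 p e < h < dot2 q e.
Proof.
move=> sa sb /andP[ah hb] gen.
have e0 : 0 < dot2 e e by apply: (@dot2_gt0 e a b); lra.
pose crossing := [seq u <- allpairs pair s s | dot2 u.1 e < h < dot2 u.2 e].
have crossingP p q : ((p, q) \in crossing) =
    [&& p \in s, q \in s, dot2 p e < h & h < dot2 q e].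
  apply/idP/idP => [|/and4P[sp sq ph hq]].
    rewrite mem_filter /= => /andP[+ /allpairsP[[p' q'] [/= sp' sq' [pE qE]]]].
    by rewrite pE qE sp' sq'.
  by rewrite mem_filter /= ph hq; apply/allpairsP; exists (p, q).
have [[p0 q0] cr0 min0] : exists2 u, u \in crossing & forall v, v \in crossing ->
    height e h u.1 u.2 <= height e h v.1 v.2.
  by apply: (@seq_argmin _ _ (fun u => height e h u.1 u.2) _ (a, b)); rewrite crossingP sa sb ah.
pose lowest := [seq u <- crossing | height e h u.1 u.2 == height e h p0 q0].
have [[p q]] : exists2 u, u \in lowest & forall v, v \in lowest ->
    dot2 u.2 e - dot2 u.1 e <= dot2 v.2 e - dot2 v.1 e.
  apply: (@seq_argmin _ _ (fun u => dot2 u.2 e - dot2 u.1 e) _ (p0, q0)).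
  by rewrite mem_filter /= eqxx.
rewrite mem_filter /= => /andP[/eqP hpq crpq] min1.
have {min0} minH v : v \in crossing -> height e h p q <= height e h v.1 v.2.
  by move=> /min0; rewrite hpq.
have {hpq} minW v : v \in crossing -> height e h v.1 v.2 = height e h p q ->
    dot2 q e - dot2 p e <= dot2 v.2 e - dot2 v.1 e.
  by move=> cv hv; apply: min1; rewrite mem_filter cv hv hpq eqxx.
move: (crpq); rewrite crossingP => /and4P[sp sq ph hq].
have xpq : 0 < dot2 q e - dot2 p e by lra.
have heightl r : h < dot2 r e -> height e h p r - height e h p q =
    (h - dot2 p e) * (cross2 (sub2 q p) (sub2 r p) * dot2 e e) /
    ((dot2 q e - dot2 p e) * (dot2 r e - dot2 p e)).
  move=> hr; rewrite cross2_frame /height; field; apply/andP; split; apply/eqP; lra.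
have heightr r : dot2 r e < h -> height e h r q - height e h p q =
    (dot2 q e - h) * (cross2 (sub2 q p) (sub2 r p) * dot2 e e) /
    ((dot2 q e - dot2 p e) * (dot2 q e - dot2 r e)).
  move=> hr; rewrite cross2_frame /height; field; apply/andP; split; apply/eqP; lra.
exists p, q; split; last by rewrite ph.
apply/and5P; split => //.
- by apply: contraTneq xpq => ->; rewrite subrr ltxx.
- apply/asboolP => r sr.
  have [hr|rh|/eqP] := ltgtP (dot2 r e) h; last by rewrite (negbTE (gen r sr)).
    have /minH/= : (r, q) \in crossing by rewrite crossingP sr sq hr.
    rewrite -subr_ge0 heightr// mulrCA -mulrA pmulr_lge0//.
    by rewrite divr_gt0 ?mulr_gt0//; lra.
  have /minH/= : (p, r) \in crossing by rewrite crossingP sr sp ph.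
  rewrite -subr_ge0 heightl// mulrCA -mulrA pmulr_lge0//.
  by rewrite divr_gt0 ?mulr_gt0//; lra.
apply/asboolP => r sr [t /andP[t0 t1] rE].
have xr : dot2 r e = dot2 p e + t * (dot2 q e - dot2 p e).
  by rewrite rE /dot2 /=; ring.
have cr0' : cross2 (sub2 q p) (sub2 r p) = 0 by rewrite rE /cross2 /=; ring.
have rp : dot2 p e < dot2 r e by rewrite xr ltrDl mulr_gt0.
have rq : dot2 r e < dot2 q e by rewrite xr -ltrBrDl gtr_pMl.
have [hr|rh|/eqP] := ltgtP (dot2 r e) h; last by rewrite (negbTE (gen r sr)).
  have /minW/= : (r, q) \in crossing by rewrite crossingP sr sq hr.
  suff -> : height e h r q = height e h p q by move=> /(_ erefl); lra.
  by apply/eqP; rewrite -subr_eq0 heightr// cr0' mul0r mulr0 mul0r.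
have /minW/= : (p, r) \in crossing by rewrite crossingP sr sp ph.
suff -> : height e h p r = height e h p q by move=> /(_ erefl); lra.
by apply/eqP; rewrite -subr_eq0 heightl// cr0' mul0r mulr0 mul0r.
Qed.

Lemma crossing_edge_unique s e h p q p' q' :
  hull_edge s p q -> dot2 p e < h < dot2 q e ->
  hull_edge s p' q' -> dot2 p' e < h < dot2 q' e -> (p, q) = (p', q').
Proof.
move=> /and5P[sp sq _ /asboolP left /asboolP open] /andP[ph hq].
move=> /and5P[sp' sq' _ /asboolP left' /asboolP open'] /andP[p'h hq'].
have e0 : 0 < dot2 e e by apply: (@dot2_gt0 e p q); lra.
pose D a b r := cross2 (sub2 b a) (sub2 r a) * dot2 e e.
have D0 r : r \in s -> 0 <= D p q r by move=> sr; rewrite /D mulr_ge0 ?left// ltW.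
have D0' r : r \in s -> 0 <= D p' q' r by move=> sr; rewrite /D mulr_ge0 ?left'// ltW.
have heightB a b a' b' : dot2 a e < h -> h < dot2 b e ->
    dot2 a' e < h -> h < dot2 b' e ->
    (height e h a' b' - height e h a b) *
    ((dot2 b e - dot2 a e) * (dot2 b' e - dot2 a' e)) =
    (dot2 b' e - h) * D a b a' + (h - dot2 a' e) * D a b b'.
  move=> ah hb ah' hb'; rewrite /D !cross2_frame /height; field.
  by apply/andP; split; apply/eqP; lra.
have xpq : 0 < dot2 q e - dot2 p e by lra.
have xpq' : 0 < dot2 q' e - dot2 p' e by lra.
have Hpp' : height e h p q = height e h p' q'.
  apply/eqP; rewrite eq_le; apply/andP; split; rewrite -subr_ge0.
    rewrite -(pmulr_lge0 _ (mulr_gt0 xpq xpq')) heightB//.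
    by rewrite addr_ge0// mulr_ge0 ?D0//; lra.
  rewrite -(pmulr_lge0 _ (mulr_gt0 xpq' xpq)) heightB//.
  by rewrite addr_ge0// mulr_ge0 ?D0'//; lra.
have zero2 (u v A B : R) : 0 < u -> 0 < v -> 0 <= A -> 0 <= B ->
    u * A + v * B = 0 -> A = 0 /\ B = 0.
  move=> u0 v0 A0 B0 /eqP; rewrite paddr_eq0; last 2 first.
  - exact: mulr_ge0 (ltW u0) A0.
  - exact: mulr_ge0 (ltW v0) B0.
  rewrite !mulf_eq0.
  by rewrite (gt_eqF u0) (gt_eqF v0) /= => /andP[/eqP-> /eqP->].
have Dp'q' : D p q p' = 0 /\ D p q q' = 0.
  apply: (zero2 (dot2 q' e - h) (h - dot2 p' e)); rewrite ?subr_gt0 ?D0//.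
  by rewrite -heightB// Hpp' subrr mul0r.
have Dpq : D p' q' p = 0 /\ D p' q' q = 0.
  apply: (zero2 (dot2 q e - h) (h - dot2 p e)); rewrite ?subr_gt0 ?D0'//.
  by rewrite -heightB// Hpp' subrr mul0r.
have inseg a b r : D a b r = 0 -> dot2 a e < dot2 r e -> dot2 r e < dot2 b e ->
    in_open_seg a b r.
  rewrite /D cross2_frame => /eqP; rewrite subr_eq0 => /eqP Dr ar rb.
  by apply: (frame_open_seg e0) => //; rewrite ar.
have coll a b r r' : dot2 a e < dot2 b e -> D a b r = 0 -> D a b r' = 0 ->
    dot2 r e = dot2 r' e -> r = r'.
  move=> ab; rewrite /D !cross2_frame => Dr Dr' rr'; apply: (frame_inj e0) => //.
  rewrite -rr' in Dr'; have ab0 : dot2 b e - dot2 a e != 0 by apply/eqP; lra.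
  by apply: (addIr (- cross2 e a)); apply: (mulfI ab0); lra.
have Dpp : D p q p = 0 by rewrite /D cross2_frame; ring.
have Dqq : D p q q = 0 by rewrite /D cross2_frame; ring.
have pE : p = p'.
  apply: (coll p q); [lra | exact: Dpp | exact: Dp'q'.1 |].
  have [pp'|p'p|//] := ltgtP (dot2 p e) (dot2 p' e).
    by case: (open p' sp'); apply: inseg => //; [exact: Dp'q'.1 | lra].
  by case: (open' p sp); apply: inseg => //; [exact: Dpq.1 | lra].
have qE : q = q'.
  apply: (coll p q); [lra | exact: Dqq | exact: Dp'q'.2 |].
  have [qq'|q'q|//] := ltgtP (dot2 q e) (dot2 q' e).
    by case: (open' q sq); apply: inseg => //; [exact: Dpq.2 | lra].
  by case: (open q' sq'); apply: inseg => //; [exact: Dp'q'.2 | lra].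
by rewrite pE qE.
Qed.

End CrossingEdges.

Section Perimeter.
Context {R : realType}.
Implicit Types (s : seq (R * R)) (e p q u v : R * R) (t : R).

Definition hull_edges s : seq ((R * R) * (R * R)) :=
  [seq w <- [seq (p, q) | p <- undup s, q <- undup s] | hull_edge s w.1 w.2].

Lemma hull_edges_uniq s : uniq (hull_edges s).
Proof.
apply: filter_uniq; apply: allpairs_uniq; rewrite ?undup_uniq//.
by move=> [? ?] [? ?].
Qed.

Lemma mem_hull_edges s w : (w \in hull_edges s) = hull_edge s w.1 w.2.
Proof.
rewrite mem_filter; case: (boolP (hull_edge s w.1 w.2)) => //=.
move=> /and5P[w1 w2 _ _ _]; apply/allpairsP; exists w.
by rewrite !mem_undup w1 w2; case: w {w1 w2}.
Qed.

Lemma hull_perimeterE s :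
  hull_perimeter s = \sum_(w <- hull_edges s) norm2 (sub2 w.2 w.1).
Proof.
rewrite big_filter big_mkcond big_allpairs_dep /=.
by apply: eq_bigr => p _; rewrite -big_mkcond.
Qed.

Lemma rising_edges_sum s e a b : a \in s -> b \in s ->
  (forall r, r \in s -> dot2 a e <= dot2 r e <= dot2 b e) ->
  \sum_(w <- hull_edges s | dot2 w.1 e < dot2 w.2 e) (dot2 w.2 e - dot2 w.1 e)
  = dot2 b e - dot2 a e.
Proof.
move=> sa sb ab.
have [g [gV gE]] := gap_decomposition [seq dot2 r e | r <- s].
have Vs r : r \in s -> dot2 r e \in [seq dot2 r e | r <- s] by exact: map_f.
have {}gV k r : k \in g -> r \in s -> dot2 r e != k.1.
  by move=> /gV kV /Vs; apply: contraTneq => ->.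
rewrite [RHS](gE _ _ (Vs _ sa) (Vs _ sb)); last by case/andP: (ab b sb).
transitivity (\sum_(w <- hull_edges s | dot2 w.1 e < dot2 w.2 e)
    \sum_(k <- g | dot2 w.1 e < k.1 < dot2 w.2 e) k.2).
  rewrite big_seq_cond [RHS]big_seq_cond; apply: eq_bigr => w.
  rewrite mem_hull_edges => /andP[/and5P[w1 w2 _ _ _] /ltW]; exact/gE/Vs/w2/Vs/w1.
rewrite (exchange_big_dep xpredT)//= [RHS]big_mkcond/= big_seq [RHS]big_seq.
apply: eq_bigr => k kg; case: ifPn => [akb|Nakb]; last first.
  rewrite big_seq_cond big1// => w; rewrite mem_hull_edges.
  move=> /andP[/and5P[w1 w2 _ _ _] /andP[_ /andP[wk kw]]].
  case/negP: Nakb; apply/andP; split.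
    by case/andP: (ab _ w1) => /le_lt_trans->.
  by case/andP: (ab _ w2) => _; apply: lt_le_trans.
have [p [q [pq pkq]]] := crossing_edge_exists sa sb akb (fun r => gV k r kg).
have [pk kq] := andP pkq.
rewrite big_mkcond (bigD1_seq (p, q)) ?hull_edges_uniq ?mem_hull_edges//=.
rewrite pkq (lt_trans pk kq)/= big_seq_cond big1 ?addr0// => -[p' q'].
rewrite mem_hull_edges/= => /andP[pq' neq]; case: ifPn => // /andP[_ pkq'].
by rewrite (crossing_edge_unique pq' pkq' pq pkq) eqxx in neq.
Qed.

Lemma dot2B e p q : dot2 (sub2 q p) e = dot2 q e - dot2 p e.
Proof. by rewrite /dot2 /sub2 /=; ring. Qed.

Lemma dot2Nr e p : dot2 p (- e.1, - e.2) = - dot2 p e.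
Proof. by rewrite /dot2 /=; ring. Qed.

Lemma hull_edges_width s e a b : a \in s -> b \in s ->
  (forall r, r \in s -> dot2 a e <= dot2 r e <= dot2 b e) ->
  \sum_(w <- hull_edges s) `|dot2 (sub2 w.2 w.1) e| = 2 * (dot2 b e - dot2 a e).
Proof.
move=> sa sb ab.
have up := rising_edges_sum sa sb ab.
have down := @rising_edges_sum s (- e.1, - e.2) b a sb sa.
rewrite mulr_natl mulr2n -[X in X + _]up.
have -> : dot2 b e - dot2 a e =
    dot2 a (- e.1, - e.2) - dot2 b (- e.1, - e.2) by rewrite !dot2Nr; ring.
rewrite -down; last by move=> r /ab; rewrite !dot2Nr !lerN2 andbC.
rewrite (big_mkcond (fun w => dot2 w.1 e < dot2 w.2 e)).
rewrite (big_mkcond (fun w => dot2 w.1 (- e.1, - e.2) < _)) -big_split.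
apply: eq_bigr => w _ /=; rewrite dot2B !dot2Nr ltrN2.
case: ltgtP => [lt|gt|->].
- by rewrite addr0 gtr0_norm// subr_gt0.
- by rewrite add0r ltr0_norm ?subr_lt0//; ring.
- by rewrite subrr normr0 addr0.
Qed.

Lemma extremal_points s e p0 : p0 \in s -> exists a b, [/\ a \in s, b \in s &
  forall r, r \in s -> dot2 a e <= dot2 r e <= dot2 b e].
Proof.
move=> sp0.
have [a sa amin] := seq_argmin (fun r => dot2 r e) sp0.
have [b sb bmin] := seq_argmin (fun r => - dot2 r e) sp0.
by exists a, b; split => // r sr; rewrite amin//= -lerN2 bmin.
Qed.

Lemma dot2_sqr u v : dot2 u u = 1 ->
  dot2 v v = dot2 v u ^+ 2 + dot2 v (- u.2, u.1) ^+ 2.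
Proof.
move=> u1; transitivity (dot2 v v * dot2 u u); first by rewrite u1 mulr1.
by rewrite /dot2 /=; ring.
Qed.

Lemma dot2_ge0 v : 0 <= dot2 v v.
Proof. by rewrite /dot2 -!expr2 addr_ge0// sqr_ge0. Qed.

Lemma le_dot2_norm2 u v : dot2 u u = 1 -> `|dot2 v u| <= norm2 v.
Proof.
move=> u1; rewrite -sqrtr_sqr ler_sqrt ?dot2_ge0// (dot2_sqr v u1).
by rewrite lerDl sqr_ge0.
Qed.

(* The right-hand side is a polyhedral norm whose unit ball is a hexagon; it is
   larger than the Euclidean norm by only [O(t ^ 2)] on multiples of [u]. *)
Lemma norm2_le_hexagon u v t : dot2 u u = 1 -> 0 <= t <= 1 ->
  norm2 v <= (1 + t ^+ 2 - t) * `|dot2 v u| +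
    2^-1 * `|dot2 v (t * u.1 - u.2, t * u.2 + u.1)| +
    2^-1 * `|dot2 v (t * u.1 + u.2, t * u.2 - u.1)|.
Proof.
move=> u1 /andP[t0 t1]; rewrite /norm2 (dot2_sqr v u1).
set x := dot2 v u; set y := dot2 v (- u.2, u.1).
have -> : dot2 v (t * u.1 - u.2, t * u.2 + u.1) = t * x + y.
  by rewrite /x /y /dot2 /=; ring.
have -> : dot2 v (t * u.1 + u.2, t * u.2 - u.1) = t * x - y.
  by rewrite /x /y /dot2 /=; ring.
have x0 := normr_ge0 x; have y0 := normr_ge0 y.
rewrite -[x ^+ 2]real_normK ?num_real// -[y ^+ 2]real_normK ?num_real//.
have tx0 : 0 <= t * `|x| by rewrite mulr_ge0.
have maxE : Num.max (t * `|x|) `|y| <=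
    2^-1 * `|t * x + y| + 2^-1 * `|t * x - y|.
  have txE : t * `|x| = `|t * x| by rewrite normrM (ger0_norm t0).
  rewrite ge_max txE; apply/andP; split.
    have := ler_normD (t * x + y) (t * x - y).
    rewrite (_ : t * x + y + (t * x - y) = 2 * (t * x)); last by ring.
    by rewrite normrM (ger0_norm (ler0n _ 2)) => ?; lra.
  have := ler_normB (t * x + y) (t * x - y).
  rewrite (_ : t * x + y - (t * x - y) = 2 * y); last by ring.
  by rewrite normrM (ger0_norm (ler0n _ 2)) => ?; lra.
rewrite -addrA; apply: le_trans (lerD (lexx _) maxE) => {maxE}.
move: x0 y0 tx0; set X := `|x|; set Y := `|y| => x0 y0 tx0.
have m0 : 0 <= Num.max (t * X) Y by rewrite le_max tx0.
have c0 : 0 <= 1 + t ^+ 2 - t by nra.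
rewrite -(ger0_norm (addr_ge0 (mulr_ge0 c0 x0) m0)) -sqrtr_sqr ler_sqrt ?sqr_ge0//.
have X20 := sqr_ge0 X; have t20 := sqr_ge0 t.
have [Yt|tY] := leP Y (t * X).
  have : Y ^+ 2 <= (t * X) ^+ 2 by rewrite lerXn2r.
  have : 0 <= (t ^+ 2 + (t ^+ 2) ^+ 2) * X ^+ 2 by rewrite mulr_ge0// addr_ge0// sqr_ge0.
  nra.
have : 0 <= (1 + t ^+ 2 - t) * X * (Y - t * X) by rewrite !mulr_ge0// subr_ge0 ltW.
have : 0 <= (t ^+ 2 + (t ^+ 2) ^+ 2) * X ^+ 2 by rewrite mulr_ge0// addr_ge0// sqr_ge0.
nra.
Qed.

Lemma le_hull_perimeter s u p q : dot2 u u = 1 -> p \in s -> q \in s ->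
  2 * dot2 (sub2 q p) u <= hull_perimeter s.
Proof.
move=> u1 sp sq; have [a [b [sa sb ab]]] := extremal_points u sp.
have /andP[_ qb] := ab _ sq; have /andP[ap _] := ab _ sp.
apply: (@le_trans _ _ (2 * (dot2 b u - dot2 a u))); first by rewrite dot2B; lra.
rewrite -(hull_edges_width sa sb ab) hull_perimeterE.
by apply: ler_sum => w _; exact: le_dot2_norm2.
Qed.

Lemma hull_edges_width_le s e p0 (B : R) : p0 \in s ->
  (forall p q, p \in s -> q \in s -> dot2 (sub2 q p) e <= B) ->
  \sum_(w <- hull_edges s) `|dot2 (sub2 w.2 w.1) e| <= 2 * B.
Proof.
move=> sp0 sB; have [a [b [sa sb ab]]] := extremal_points e sp0.
by rewrite (hull_edges_width sa sb ab) ler_pM2l// -dot2B sB.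
Qed.

Lemma hull_perimeter_le s u t p0 (B Bl Br : R) :
  dot2 u u = 1 -> 0 <= t <= 1 -> p0 \in s ->
  (forall p q, p \in s -> q \in s -> dot2 (sub2 q p) u <= B) ->
  (forall p q, p \in s -> q \in s ->
    dot2 (sub2 q p) (t * u.1 - u.2, t * u.2 + u.1) <= Bl) ->
  (forall p q, p \in s -> q \in s ->
    dot2 (sub2 q p) (t * u.1 + u.2, t * u.2 - u.1) <= Br) ->
  hull_perimeter s <= 2 * (1 + t ^+ 2 - t) * B + Bl + Br.
Proof.
move=> u1 t01 sp0 sB sBl sBr; rewrite hull_perimeterE.
apply: le_trans (ler_sum _ (fun w _ => norm2_le_hexagon (sub2 w.2 w.1) u1 t01)) _.
rewrite !big_split/= -!mulr_sumr.
have c0 : 0 <= 1 + t ^+ 2 - t by case/andP: t01 => t0 t1; nra.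
have {sB}B' := ler_wpM2l c0 (hull_edges_width_le sp0 sB).
have {sBl}Bl' := hull_edges_width_le sp0 sBl.
have {sBr}Br' := hull_edges_width_le sp0 sBr.
lra.
Qed.

End Perimeter.

(** * Independence of a step and a Lindley process *)

Section Independence.
Context {d} {T : measurableType d} {R : realType} (P : probability T R).

Section ExpectationProduct.
Local Open Scope ereal_scope.
Variables (U V : T -> R).
Hypotheses (mU : measurable_fun setT U) (mV : measurable_fun setT V).
Hypothesis UV : forall A B : set R, measurable A -> measurable B ->
  P (U @^-1` A `&` V @^-1` B) = P (U @^-1` A) * P (V @^-1` B).

Lemma integral_mul_independent :
  P.-integrable setT (EFin \o U) -> P.-integrable setT (EFin \o V) ->
  P.-integrable setT (EFin \o (U \* V)%R) ->
  \int[P]_x (U x * V x)%:E = (\int[P]_x (U x)%:E) * (\int[P]_x (V x)%:E).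
Proof.
move=> iU iV iUV.
pose U' : {mfun T >-> R} := HB.pack U (isMeasurableFun.Build _ _ _ _ _ mU).
pose V' : {mfun T >-> R} := HB.pack V (isMeasurableFun.Build _ _ _ _ _ mV).
pose W : T -> R * R := fun x => (U x, V x).
have mW : measurable_fun setT W by exact: measurable_fun_pair.
pose W' : {mfun T >-> (R * R)%type} := HB.pack W (isMeasurableFun.Build _ _ _ _ _ mW).
pose lawW : {measure set (R * R) -> \bar R} := distribution P W'.
pose lawUV : {measure set (R * R) -> \bar R} := (distribution P U' \x distribution P V').
have prodE (A : set (R * R)) : measurable A ->
    lawUV A = lawW A.
  by apply: product_measure_unique => B C mB mC; exact: UV.
pose f (z : R * R) := (z.1 * z.2)%:E.
have mf : measurable_fun setT f.
  apply/measurable_EFinP; apply: measurable_funM.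
    exact: measurable_fst.
  exact: measurable_snd.
have iWf : lawW.-integrable setT f.
  exact: (integrable_pushforward mW).
have ipf : lawUV.-integrable setT f.
  apply/integrableP; split => //.
  rewrite (eq_measure_integral lawW).
    by case/integrableP: iWf.
  by move=> A mA _; exact: prodE.
have mid : measurable_fun setT (EFin : R -> \bar R) by exact/measurable_EFinP.
have idV : (distribution P V').-integrable setT (EFin : R -> \bar R).
  exact: (integrable_pushforward mV).
have idU : (distribution P U').-integrable setT (EFin : R -> \bar R).
  exact: (integrable_pushforward mU).
have -> : \int[P]_x (U x * V x)%:E = \int[lawW]_z f z.
  by rewrite integral_distribution.
rewrite -(eq_measure_integral _ (fun A mA _ => prodE A mA)).
rewrite -integral12_prod_meas1// /fubini_F.
have -> : \int[P]_x (V x)%:E = \int[distribution P V']_y y%:E.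
  by rewrite integral_distribution.
have -> : \int[P]_x (U x)%:E = \int[distribution P U']_y y%:E.
  by rewrite integral_distribution.
have finV := integrable_fin_num measurableT idV.
rewrite -(fineK finV) muleC -integralZl//.
apply: eq_integral => u _.
by rewrite /f/= fineK// muleC -integralZl.
Qed.

End ExpectationProduct.
End Independence.

Definition lindley {T : Type} {R : realType} (X : nat -> T -> R) (s : seq nat) (x : T) : R :=
  foldr (fun i w => Num.max (w - X i x) 0) 0 s.

Section Cylinders.
Context {d} {T : measurableType d} {R : realType} (P : probability T R).
Variable Z : nat -> T -> R * R.
Hypothesis mZ : forall i, measurable_fun setT (Z i).

Definition cylinders (s : seq nat) : set (set T) :=
  [set E | exists2 A : nat -> set (R * R), (forall j, measurable (A j)) &
     E = \big[setI/setT]_(j <- s) (Z j @^-1` A j)].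

Lemma measurable_preimageZ i (A : set (R * R)) : measurable A -> measurable (Z i @^-1` A).
Proof. by move=> mA; rewrite -[X in measurable X]setTI; exact: mZ. Qed.

Lemma cylinders_measurable s : cylinders s `<=` measurable.
Proof.
move=> _ [A mA ->]; elim: s => [|i s IH]; first by rewrite big_nil.
by rewrite big_cons; apply: measurableI => //; exact: measurable_preimageZ.
Qed.

Lemma cylinders_setT s : cylinders s setT.
Proof. by exists (fun=> setT) => //; rewrite big1. Qed.

Lemma cylinders_setI s : setI_closed (cylinders s).
Proof.
move=> _ _ [A mA ->] [B mB ->]; exists (fun j => A j `&` B j).
  by move=> j; exact: measurableI.
by rewrite -big_split.
Qed.

Lemma cylinders_preimage s i (A : set (R * R)) : uniq s -> i \in s -> measurable A ->
  cylinders s (Z i @^-1` A).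
Proof.
move=> us si mA; exists (fun j => if j == i then A else setT).
  by move=> j; case: ifP.
rewrite (bigD1_seq i)//= eqxx big1 ?setIT// => j /negbTE ->.
by rewrite preimage_setT.
Qed.

Hypothesis indepZ : independent_rvecs P Z.

Lemma independent_cylinders s i (B : set (R * R)) E : uniq (i :: s) ->
  measurable B -> <<s cylinders s >> E ->
  P (E `&` Z i @^-1` B) = (P E * P (Z i @^-1` B))%E.
Proof.
move=> /= /andP[si us] mB.
have mZB := measurable_preimageZ i mB.
have p0 : 0 <= fine (P (Z i @^-1` B)) by rewrite fine_ge0.
have pE : (fine (P (Z i @^-1` B)))%:E = P (Z i @^-1` B).
  by rewrite fineK// fin_num_measure.
pose m1 : {measure set T -> \bar R} := mrestr P mZB.
pose m2 : {measure set T -> \bar R} := mscale (NngNum p0) P.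
have m2E F : m2 F = (P (Z i @^-1` B) * P F)%E by rewrite -pE.
move=> sE; rewrite muleC -m2E.
apply: (@g_sigma_algebra_measure_unique _ _ _ (cylinders s) _ (fun=> setT) _ _ m1 m2) => //.
- exact: cylinders_measurable.
- by move=> _; exact: cylinders_setT.
- by rewrite bigcup_const.
- exact: cylinders_setI.
- move=> _ [A mA ->]; rewrite m2E /m1 /mrestr /=.
  pose A' j := if j == i then B else A j.
  have mA' j : measurable (A' j) by rewrite /A'; case: ifP.
  have A'E : \big[setI/setT]_(j <- s) (Z j @^-1` A' j) =
      \big[setI/setT]_(j <- s) (Z j @^-1` A j).
    rewrite big_seq [RHS]big_seq; apply: eq_bigr => j sj.
    by rewrite /A'; case: eqP sj si => // -> ->.
  have := @indepZ (i :: s) A'; rewrite /= si us => /(_ erefl mA').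
  by rewrite !big_cons -(@indepZ s A' us mA') A'E /A' eqxx setIC => <-.
- by move=> _; rewrite /m1 /mrestr/= (le_lt_trans (probability_le1 _ _))// ?ltry//; exact: measurableI.
Qed.

Variable e : R * R.
Let X i x := dot2 (Z i x) e.

Lemma measurable_dot2 (d' : measure_display) (T' : measurableType d') (f : T' -> R * R) :
  measurable_fun setT f -> measurable_fun setT (fun x => dot2 (f x) e).
Proof.
move=> /measurable_fun_pairP[m1 m2].
by apply: measurable_funD; apply: measurable_funM => //; exact: measurable_cst.
Qed.

Lemma measurable_lindley (d' : measure_display) (T' : measurableType d') (Y : nat -> T' -> R) s :
  (forall i, i \in s -> measurable_fun setT (Y i)) -> measurable_fun setT (lindley Y s).
Proof.
elim: s => [|i s IH] mY; first exact: measurable_cst.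
apply: measurable_maxr; last exact: measurable_cst.
apply: measurable_funB; last by apply: mY; rewrite mem_head.
by apply: IH => j sj; apply: mY; rewrite in_cons sj orbT.
Qed.

Lemma lindley_cylinders s (D : set R) : uniq s -> measurable D ->
  <<s cylinders s >> (lindley X s @^-1` D).
Proof.
move=> us mD.
have mW : measurable_fun setT (lindley X s : g_sigma_algebraType (cylinders s) -> R).
  apply: measurable_lindley => i si; apply: measurable_dot2 => _ A mA.
  by rewrite setTI; apply: sub_sigma_algebra; exact: cylinders_preimage.
by have := mW measurableT D mD; rewrite setTI.
Qed.

Lemma lindley_independent s i (A B : set R) (g : R -> R) : uniq (i :: s) ->
  measurable_fun setT g -> measurable A -> measurable B ->
  P ((g \o lindley X s) @^-1` A `&` X i @^-1` B) =
  (P ((g \o lindley X s) @^-1` A) * P (X i @^-1` B))%E.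
Proof.
move=> us mg mA mB.
have mgA : measurable (g @^-1` A) by rewrite -[X in measurable X]setTI; exact: mg.
have mdB : measurable ((fun z : R * R => dot2 z e) @^-1` B).
  by rewrite -[X in measurable X]setTI; apply: (measurable_dot2 (@measurable_id _ _ _)).
have := independent_cylinders us mdB (lindley_cylinders _ mgA).
by apply; case/andP: us.
Qed.

End Cylinders.

(** * Second moment of a Lindley process *)

Section SquareIntegrable.
Context {d} {T : measurableType d} {R : realType} (P : probability T R).
Implicit Types f g : T -> R.

Definition sq_integrable f := measurable_fun setT f /\
  P.-integrable setT (EFin \o (fun x => f x ^+ 2)).

Lemma integrable_le f g : measurable_fun setT g ->
  P.-integrable setT (EFin \o f) -> (forall x, `|g x| <= f x) ->
  P.-integrable setT (EFin \o g).
Proof.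
move=> mg intf gf; apply: le_integrable intf => //; first exact/measurable_EFinP.
by move=> x _ /=; rewrite lee_fin (le_trans (gf x))// ler_norm.
Qed.

Lemma integrable_addr f g : P.-integrable setT (EFin \o f) ->
  P.-integrable setT (EFin \o g) -> P.-integrable setT (EFin \o (f \+ g)).
Proof. by move=> intf intg; exact: (integrableD measurableT intf intg). Qed.

Lemma integrable_scaler (k : R) f : P.-integrable setT (EFin \o f) ->
  P.-integrable setT (EFin \o (fun x => k * f x)).
Proof. by move=> intf; exact: (integrableZl measurableT k intf). Qed.

Lemma sq_integrable_le f g : measurable_fun setT g -> sq_integrable f ->
  (forall x, `|g x| <= `|f x|) -> sq_integrable g.
Proof.
move=> mg [mf f2] gf; split => //; apply: integrable_le f2 _.
  exact: measurable_funX.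
by move=> x; rewrite normrX -[f x ^+ 2]real_normK ?num_real// lerXn2r ?nnegrE.
Qed.

Lemma sq_integrable_mul f g : sq_integrable f -> sq_integrable g ->
  P.-integrable setT (EFin \o (f \* g)).
Proof.
move=> [mf f2] [mg g2]; apply: integrable_le (integrable_addr f2 g2) _ => /=.
  exact: measurable_funM.
move=> x; rewrite normrM -[f x ^+ 2]real_normK ?num_real//.
rewrite -[g x ^+ 2]real_normK ?num_real//.
by have := normr_ge0 (f x); have := normr_ge0 (g x); nra.
Qed.

Lemma sq_integrable_cst k : sq_integrable (fun=> k).
Proof.
split; first exact: measurable_cst.
exact: (finite_measure_integrable_cst P (k ^+ 2) measurableT).
Qed.

Lemma sq_integrable_integrable f : sq_integrable f -> P.-integrable setT (EFin \o f).
Proof.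
move=> f2; have := sq_integrable_mul f2 (sq_integrable_cst 1).
by apply: eq_integrable => // x _ /=; rewrite mulr1.
Qed.

Lemma sq_integrableD f g : sq_integrable f -> sq_integrable g ->
  sq_integrable (f \+ g).
Proof.
move=> [mf f2] [mg g2]; split; first exact: measurable_funD.
apply: integrable_le (integrable_scaler 2 (integrable_addr f2 g2)) _ => /=.
  by apply: measurable_funX; exact: measurable_funD.
move=> x; rewrite ger0_norm ?sqr_ge0//.
by have := sqr_ge0 (f x - g x); nra.
Qed.

Lemma sq_integrableZ k f : sq_integrable f -> sq_integrable (fun x => k * f x).
Proof.
move=> [mf f2]; split.
  by apply: measurable_funM => //; exact: measurable_cst.
have := integrable_scaler (k ^+ 2) f2.
by apply: eq_integrable => // x _ /=; rewrite exprMn.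
Qed.

Lemma sq_integrable_sum (F : nat -> T -> R) n : (forall i, sq_integrable (F i)) ->
  sq_integrable (fun x => \sum_(i < n) F i x).
Proof.
move=> F2; elim: n => [|n IH].
  have -> : (fun x => \sum_(i < 0) F i x) = fun=> 0.
    by apply/funext => x; rewrite big_ord0.
  exact: sq_integrable_cst.
have -> : (fun x => \sum_(i < n.+1) F i x) = (fun x => \sum_(i < n) F i x) \+ F n.
  by apply/funext => x; rewrite big_ord_recr.
exact: sq_integrableD.
Qed.

Lemma Rexpectation_le f g : P.-integrable setT (EFin \o f) ->
  P.-integrable setT (EFin \o g) -> (forall x, f x <= g x) ->
  \int[P]_x f x <= \int[P]_x g x.
Proof. by move=> intf intg fg; apply: le_Rintegral. Qed.

Lemma RexpectationDZ k f g : P.-integrable setT (EFin \o f) ->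
  P.-integrable setT (EFin \o g) ->
  \int[P]_x (f x + k * g x) = \int[P]_x f x + k * \int[P]_x g x.
Proof.
move=> intf intg; rewrite (RintegralD measurableT intf (integrable_scaler k intg)).
by rewrite RintegralZl.
Qed.

End SquareIntegrable.

Lemma lindley_ge0 {T : Type} {R : realType} (X : nat -> T -> R) s x : 0 <= lindley X s x.
Proof. by case: s => //= i s; rewrite le_max lexx orbT. Qed.

(* The function [w |-> Num.max (w - A) 0 ^+ 2] vanishes on [[0, A]], so a step
   from [w <= A / 2] increases it only through the large values of [x ^+ 2]. *)
Lemma lindley_step {R : realType} (A b w x : R) : 0 < A -> 0 <= b -> 8 * b <= A ^+ 2 ->
  0 <= w ->
  Num.max (Num.max (w - x) 0 - A) 0 ^+ 2 <=
  Num.max (w - A) 0 ^+ 2 - 2 * Num.max (w - A) 0 * x + 4 * b / A * w +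
    2 * Num.max (x ^+ 2 - b) 0.
Proof.
move=> A0 b0 bA w0; have x20 := sqr_ge0 x.
have m0 : 0 <= Num.max (x ^+ 2 - b) 0 by rewrite le_max lexx orbT.
have q0 : 0 <= 4 * b / A * w by rewrite !mulr_ge0// invr_ge0 ltW.
have key : x ^+ 2 <= 4 * b / A * w + 2 * Num.max (x ^+ 2 - b) 0 \/
    w <= A / 2 /\ - x <= A / 2.
  have [xb|bx] := leP (2 * b) (x ^+ 2).
    left; have : x ^+ 2 - b <= Num.max (x ^+ 2 - b) 0 by rewrite le_max lexx.
    lra.
  have [wA|Aw] := leP w (A / 2); [right; split => // | left].
    have [//|Ax] := leP (- x) (A / 2).
    have : (A / 2) ^+ 2 < (- x) ^+ 2 by rewrite ltrXn2r// ?nnegrE; lra.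
    by rewrite sqrrN expr_div_n; lra.
  have : 4 * b / A * (A / 2) <= 4 * b / A * w.
    by apply: ler_wpM2l (ltW Aw); rewrite !mulr_ge0// invr_ge0 ltW.
  rewrite [X in X <= _ -> _](_ : _ = 2 * b); last by field; rewrite gt_eqF.
  lra.
have [u0|u0] := leP 0 (w - A).
  have wx : Num.max (Num.max (w - x) 0 - A) 0 ^+ 2 <= (w - A - x) ^+ 2.
    have [wxA|wxA] := leP A (w - x).
      have -> : Num.max (w - x) 0 = w - x by apply/max_idPl; lra.
      have -> : Num.max (w - x - A) 0 = w - x - A by apply/max_idPl; lra.
      by rewrite (_ : w - A - x = w - x - A) ?lexx//; ring.
    have -> : Num.max (Num.max (w - x) 0 - A) 0 = 0.
      by apply/max_idPr; rewrite subr_le0 ge_max (ltW wxA) ltW.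
    by rewrite expr0n/= sqr_ge0.
  case: key => [key|[wA _]]; last lra.
  by apply: le_trans wx _; nra.
rewrite mulr0 mul0r expr0n/= subr0 add0r.
have [wxA|wxA] := leP (w - x) A.
  have -> : Num.max (Num.max (w - x) 0 - A) 0 = 0.
    by apply/max_idPr; rewrite subr_le0 ge_max wxA ltW.
  by rewrite expr0n/= addr_ge0// mulr_ge0.
case: key => [key|[wA xA]]; last lra.
apply: le_trans key.
have -> : Num.max (w - x) 0 = w - x by apply/max_idPl; lra.
have -> : Num.max (w - x - A) 0 = w - x - A by apply/max_idPl; lra.
by rewrite -[x ^+ 2]sqrrN lerXn2r// ?nnegrE; lra.
Qed.

Section LindleyMoment.
Context {d} {T : measurableType d} {R : realType} (P : probability T R).
Variables (Z : nat -> T -> R * R) (e : R * R).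
Hypothesis mZ : forall i, measurable_fun setT (Z i).
Hypothesis indepZ : independent_rvecs P Z.
Let X i x := dot2 (Z i x) e.
Hypothesis X2 : forall i, sq_integrable P (X i).

Lemma lindley_sq_integrable s : sq_integrable P (lindley X s).
Proof.
elim: s => [|i s IH]; first exact: sq_integrable_cst.
apply: (@sq_integrable_le _ _ _ _ (lindley X s \+ (fun x => -1 * X i x))).
- by apply: measurable_lindley => j _; case: (X2 j).
- by apply: sq_integrableD => //; exact: sq_integrableZ.
- move=> x /=; rewrite mulN1r (ger0_norm (lindley_ge0 X (i :: s) x)) /=.
  by rewrite ge_max ler_norm normr_ge0.
Qed.

Lemma expectation_lindley_mul s i (g : R -> R) : uniq (i :: s) ->
  measurable_fun setT g -> sq_integrable P (g \o lindley X s) ->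
  \int[P]_x (g (lindley X s x) * X i x) =
  \int[P]_x g (lindley X s x) * \int[P]_x X i x.
Proof.
move=> us mg g2; rewrite /Rintegral.
have iX := sq_integrable_integrable (X2 i).
have ig := sq_integrable_integrable g2.
rewrite (integral_mul_independent (U := g \o lindley X s) (V := X i)) //.
- by rewrite fineM// ?(integrable_fin_num measurableT).
- by case: g2.
- by case: (X2 i).
- by move=> A B mA mB; exact: lindley_independent.
- exact: sq_integrable_mul.
Qed.

Variables (m V tau A b : R).
Hypotheses (m0 : 0 < m) (A0 : 0 < A) (b0 : 0 <= b) (bA : 8 * b <= A ^+ 2).
Hypothesis Xm : forall i, m <= \int[P]_x X i x.
Hypothesis XV : forall i, \int[P]_x X i x ^+ 2 <= V.
Hypothesis Xtau : forall i, \int[P]_x (2 * Num.max (X i x ^+ 2 - b) 0) <= tau.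

(* [k] makes the drift term [- 2 k w E X] of [k * w ^+ 2] absorb the linear term
   [4 b / A * w] produced by [lindley_step]. *)
Let k := 2 * b / (A * m).
Let pot (w : R) := Num.max (w - A) 0 ^+ 2 + k * w ^+ 2.

Lemma expectation_potential_le s : uniq s ->
  \int[P]_x pot (lindley X s x) <= (size s)%:R * (tau + k * V).
Proof.
have k0 : 0 <= k by rewrite divr_ge0 ?mulr_ge0// ltW.
have km : 2 * k * m = 4 * b / A.
  by rewrite /k; field; rewrite !gt_eqF.
pose g (w : R) := Num.max (w - A) 0.
have mg : measurable_fun setT g.
  apply: measurable_maxr; last exact: measurable_cst.
  by apply: measurable_funB => //; exact: measurable_cst.
elim: s => [_|i s IH us].
  under eq_Rintegral do rewrite /pot /= sub0r (max_idPr _) ?oppr_le0 ?(ltW A0)// !expr0n/= mulr0 addr0.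
  by rewrite Rintegral_cst// mul0r mul0r.
have {}IH := IH (andP us).2.
pose W := lindley X s.
have W2 : sq_integrable P W := lindley_sq_integrable s.
have mW : measurable_fun setT W by case: W2.
have W0 x : 0 <= W x := lindley_ge0 X s x.
have g2 t : sq_integrable P (g \o lindley X t).
  apply: sq_integrable_le (lindley_sq_integrable t) _.
    by apply: measurableT_comp => //; case: (lindley_sq_integrable t).
  move=> x /=; have w0 := lindley_ge0 X t x.
  rewrite !ger0_norm//; last by rewrite le_max lexx orbT.
  by rewrite ge_max w0 andbT gerBl ltW.
pose h (w : R) := g w + k * w.
have h2 : sq_integrable P (h \o W).
  exact: sq_integrableD (g2 s) (sq_integrableZ k W2).
have mh : measurable_fun setT h.
  by apply: measurable_funD => //; apply: measurable_funM => //; exact: measurable_cst.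
have pot_int t : P.-integrable setT (EFin \o (pot \o lindley X t)).
  exact: integrable_addr (g2 t).2 (integrable_scaler k (lindley_sq_integrable t).2).
have iW := sq_integrable_integrable W2.
have ih := sq_integrable_integrable h2.
have ihX : P.-integrable setT (EFin \o ((h \o W) \* X i)).
  exact: sq_integrable_mul.
have iX2 : P.-integrable setT (EFin \o (fun x => X i x ^+ 2)) by case: (X2 i).
have iM : P.-integrable setT (EFin \o (fun x => 2 * Num.max (X i x ^+ 2 - b) 0)).
  apply: integrable_scaler; apply: integrable_le iX2 _.
    apply: measurable_maxr; last exact: measurable_cst.
    apply: measurable_funB; last exact: measurable_cst.
    by apply: measurable_funX; case: (X2 i).
  move=> x; have x20 := sqr_ge0 (X i x).
  rewrite ger0_norm; last by rewrite le_max lexx orbT.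
  by rewrite ge_max x20 andbT gerBl.
pose F1 := fun x => pot (W x) + (- 2) * (h (W x) * X i x).
pose F2 := fun x => F1 x + (4 * b / A) * W x.
pose F3 := fun x => F2 x + k * X i x ^+ 2.
pose F4 := fun x => F3 x + 1 * (2 * Num.max (X i x ^+ 2 - b) 0).
have i1 : P.-integrable setT (EFin \o F1) by exact: integrable_addr (pot_int s) (integrable_scaler _ ihX).
have i2 : P.-integrable setT (EFin \o F2) by exact: integrable_addr i1 (integrable_scaler _ iW).
have i3 : P.-integrable setT (EFin \o F3) by exact: integrable_addr i2 (integrable_scaler _ iX2).
have i4 : P.-integrable setT (EFin \o F4) by exact: integrable_addr i3 (integrable_scaler _ iM).
have le4 : \int[P]_x pot (lindley X (i :: s) x) <= \int[P]_x F4 x.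
  apply: Rexpectation_le => //; first exact: pot_int.
  move=> x; rewrite /F4 /F3 /F2 /F1 /pot /h /g -/(lindley X s x) -/(W x).
  have := lindley_step (X i x) A0 b0 bA (W0 x).
  rewrite -/(W x) => st.
  have wx : Num.max (W x - X i x) 0 ^+ 2 <= (W x - X i x) ^+ 2.
    have [//|wx] := leP 0 (W x - X i x).
    by rewrite expr0n/= sqr_ge0.
  have := ler_wpM2l k0 wx.
  have -> : lindley X (i :: s) x = Num.max (W x - X i x) 0 by [].
  nra.
apply: (le_trans le4).
rewrite /F4 RexpectationDZ// /F3 RexpectationDZ// /F2 RexpectationDZ// /F1.
rewrite RexpectationDZ//; last exact: pot_int.
rewrite expectation_lindley_mul//.
have Eh0 : 0 <= \int[P]_x h (lindley X s x).
  apply: Rintegral_ge0 => x _; apply: addr_ge0; last exact: mulr_ge0 k0 (W0 x).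
  by rewrite /g le_max lexx orbT.
have EhW : k * \int[P]_x W x <= \int[P]_x h (W x).
  rewrite -RintegralZl//; apply: Rexpectation_le => //; first exact: integrable_scaler.
  by move=> x; rewrite /h lerDr /g le_max lexx orbT.
have := Xm i; have := XV i; have := Xtau i.
have -> : (size (i :: s))%:R = (size s)%:R + 1 :> R by rewrite /= -natr1.
move: IH Eh0 EhW; rewrite -/W.
set E1 := (\int[P]_x _); set E2 := (\int[P]_x _); set E3 := (\int[P]_x _).
set E4 := (\int[P]_x X i x); set E5 := (\int[P]_x _); set E6 := (\int[P]_x _).
move=> IH E20 E32 E5tau E6V mE4; rewrite -km.
have le1 := ler_wpM2l E20 mE4.
have le2 := ler_wpM2l (ltW m0) E32.
have le3 := ler_wpM2l k0 E6V.
lra.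
Qed.

Lemma lindley_second_moment s : uniq s ->
  \int[P]_x lindley X s x ^+ 2 <=
  2 * A ^+ 2 + 2 * (size s)%:R * (tau + 2 * b / (A * m) * V).
Proof.
move=> us; have := expectation_potential_le us; rewrite -/k.
have k0 : 0 <= k by rewrite /k !mulr_ge0// invr_ge0 mulr_ge0// ltW.
set q := \int[P]_x pot _.
have W2 := lindley_sq_integrable s.
have ipot : P.-integrable setT (EFin \o (pot \o lindley X s)).
  apply: integrable_addr (integrable_scaler k W2.2).
  have : sq_integrable P (fun x => Num.max (lindley X s x - A) 0).
    apply: (sq_integrable_le _ W2).
      apply: measurable_maxr; last exact: measurable_cst.
      by apply: measurable_funB; [case: W2 | exact: measurable_cst].
    move=> x /=; have w0 := lindley_ge0 X s x.
    rewrite !ger0_norm//; last by rewrite le_max lexx orbT.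
    by rewrite ge_max w0 andbT gerBl ltW.
  by case.
suff : \int[P]_x lindley X s x ^+ 2 <= 2 * A ^+ 2 + 2 * q by lra.
have icst : P.-integrable setT (EFin \o (fun=> 2 * A ^+ 2)).
  exact: (finite_measure_integrable_cst P _ measurableT).
have <- : \int[P]_x (2 * A ^+ 2 + 2 * pot (lindley X s x)) = 2 * A ^+ 2 + 2 * q.
  rewrite RexpectationDZ// Rintegral_cst//= -/q.
  by have -> : fine (P setT) = 1; rewrite ?mulr1// probability_setT.
apply: Rexpectation_le; first by case: W2.
  exact: integrable_addr icst (integrable_scaler 2 ipot).
move=> x; rewrite /pot; set w := lindley X s x.
have kw : 0 <= k * w ^+ 2 by rewrite mulr_ge0// sqr_ge0.
have w0 : 0 <= w := lindley_ge0 X s x.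
have [u|u] := leP 0 (w - A); first by have := sqr_ge0 (w - A - A); lra.
rewrite expr0n/=; have : w ^+ 2 <= A ^+ 2 by rewrite lerXn2r// ?nnegrE; lra.
by have := sqr_ge0 A; lra.
Qed.

End LindleyMoment.

(** * Perimeter of the hull of a walk *)

Section Overshoot.
Context {T : Type} {R : realType}.
Implicit Types (X : nat -> T -> R) (Z : nat -> T -> R * R) (e u : R * R) (x : T).

Lemma sum_le_lindley X n k x : (k <= n)%N ->
  \sum_(i < k) X i x <= \sum_(i < n) X i x + lindley X (rev (iota 0 n)) x.
Proof.
elim: n k => [|n IH] k; first by rewrite leqn0 => /eqP->; rewrite lerDl.
rewrite leq_eqVlt => /predU1P[->|]; first by rewrite lerDl lindley_ge0.
rewrite ltnS => /IH kn; rewrite big_ord_recr.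
have -> : rev (iota 0 n.+1) = n :: rev (iota 0 n) by rewrite -addn1 iotaD rev_cat.
rewrite /= -/(lindley X _ x).
apply: le_trans kn _; rewrite -addrA lerD2l -lerBlDl.
by rewrite le_max lexx.
Qed.

Lemma opp_sum_le_lindley X n j k x : (k <= n)%N ->
  - (\sum_(i <- iota j k) X i x) <= lindley X (iota j n) x.
Proof.
elim: n j k => [|n IH] j [|k] //=; rewrite ?big_nil ?oppr0//.
  by rewrite le_max lexx orbT.
rewrite ltnS => /(IH j.+1); rewrite big_cons -/(lindley X _ x) => kn.
by rewrite le_max; apply/orP; left; lra.
Qed.

Definition overshoot X n x := lindley X (rev (iota 0 n)) x + lindley X (iota 0 n) x.

Lemma dot2_walk Z e n x : dot2 (walk Z n x) e = \sum_(i < n) dot2 (Z i x) e.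
Proof.
apply: (big_morph (fun v => dot2 v e)).
  by move=> p q; rewrite /dot2 /add2 /=; ring.
by rewrite /dot2 /=; ring.
Qed.

Lemma walk_width_le Z e n x p q :
  p \in [seq walk Z k x | k <- iota 0 n.+1] ->
  q \in [seq walk Z k x | k <- iota 0 n.+1] ->
  dot2 (sub2 q p) e <= \sum_(i < n) dot2 (Z i x) e +
    overshoot (fun i x => dot2 (Z i x) e) n x.
Proof.
move=> /mapP[k + ->] /mapP[l + ->]; rewrite !mem_iota !add0n !ltnS /= => kn ln.
rewrite dot2B !dot2_walk /overshoot.
have := @sum_le_lindley (fun i x => dot2 (Z i x) e) n l x ln.
have := @opp_sum_le_lindley (fun i x => dot2 (Z i x) e) n 0 k x kn.
have -> : \sum_(i <- iota 0 k) dot2 (Z i x) e = \sum_(i < k) dot2 (Z i x) e.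
  by rewrite -(big_mkord xpredT (fun i => dot2 (Z i x) e)) /index_iota subn0.
lra.
Qed.

Definition hull_error Z u t n x :=
  2 * t ^+ 2 * `|\sum_(i < n) dot2 (Z i x) u| +
  2 * overshoot (fun i x => dot2 (Z i x) u) n x +
  overshoot (fun i x => dot2 (Z i x) (t * u.1 - u.2, t * u.2 + u.1)) n x +
  overshoot (fun i x => dot2 (Z i x) (t * u.1 + u.2, t * u.2 - u.1)) n x.

Lemma overshoot_ge0 X n x : 0 <= overshoot X n x.
Proof. by rewrite addr_ge0// lindley_ge0. Qed.

Lemma hull_len_bounds Z u t n x : dot2 u u = 1 -> 0 <= t <= 1 ->
  0 <= hull_len Z n x - 2 * \sum_(i < n) dot2 (Z i x) u <= hull_error Z u t n x.
Proof.
move=> u1 t01; set s := [seq walk Z k x | k <- iota 0 n.+1].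
have s0 : walk Z 0 x \in s by apply: map_f; rewrite mem_iota.
have sn : walk Z n x \in s by apply: map_f; rewrite mem_iota add0n ltnSn.
apply/andP; split.
  have := le_hull_perimeter u1 s0 sn; rewrite dot2B !dot2_walk big_ord0 subr0.
  by rewrite subr_ge0.
have := @hull_perimeter_le _ s u t _ _ _ _ u1 t01 s0
  (fun p q => @walk_width_le Z _ n x p q) (fun p q => @walk_width_le Z _ n x p q)
  (fun p q => @walk_width_le Z _ n x p q).
rewrite -/(hull_len Z n x) /hull_error.
have : \sum_(i < n) dot2 (Z i x) (t * u.1 - u.2, t * u.2 + u.1) +
    \sum_(i < n) dot2 (Z i x) (t * u.1 + u.2, t * u.2 - u.1) =
    2 * t * \sum_(i < n) dot2 (Z i x) u.
  rewrite -big_split mulr_sumr; apply: eq_bigr => i _.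
  by rewrite /dot2 /=; ring.
have := overshoot_ge0 (fun i x => dot2 (Z i x) u) n x.
set S := \sum_(i < n) dot2 (Z i x) u.
set o0 := overshoot _ n x; set o1 := overshoot _ n x; set o2 := overshoot _ n x.
set S1 := \sum_(i < n) _; set S2 := \sum_(i < n) _ => o00 S12 L.
have [t0 t1] := andP t01.
have : t ^+ 2 * S <= t ^+ 2 * `|S| by rewrite ler_wpM2l ?sqr_ge0// ler_norm.
have : (1 + t ^+ 2 - t) * o0 <= 1 * o0 by apply: ler_wpM2r => //; nra.
nra.
Qed.

End Overshoot.

(** * Second moment of the hull error *)

(* The integral of a nonnegative function is the supremum of the integrals of the
   simple functions below it, hence monotone even on nonmeasurable functions. *)
Lemma ge0_le_integral_nomeas {d} {T : measurableType d} {R : realType}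
    (mu : {measure set T -> \bar R}) (f g : T -> \bar R) :
  (forall x, 0 <= f x)%E -> (forall x, f x <= g x)%E ->
  (\int[mu]_x f x <= \int[mu]_x g x)%E.
Proof.
move=> f0 fg; have g0 x : (0 <= g x)%E := le_trans (f0 x) (fg x).
rewrite !ge0_integralTE//; apply: ereal_sup_le => _ [h hf <-].
by exists h => // x; exact: le_trans (hf x) (fg x).
Qed.

Section StepLaw.
Context {d} {T : measurableType d} {R : realType} (P : probability T R).
Variable Z : nat -> T -> R * R.
Hypothesis mZ : forall i, measurable_fun setT (Z i).
Hypothesis identZ : identically_distributed P Z.

Lemma ge0_integral_step i (f : R * R -> \bar R) : measurable_fun setT f ->
  (forall z, 0 <= f z)%E -> (\int[P]_x f (Z i x) = \int[P]_x f (Z 0%N x))%E.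
Proof.
move=> mf f0.
have tr j : (\int[P]_x f (Z j x) = \int[pushforward P (Z j)]_z f z)%E.
  by rewrite ge0_integral_pushforward.
rewrite !tr; apply: eq_measure_integral => A mA _; exact: identZ.
Qed.

Lemma integrable_step i (f : R * R -> R) : measurable_fun setT f ->
  P.-integrable setT (EFin \o (f \o Z 0%N)) -> P.-integrable setT (EFin \o (f \o Z i)).
Proof.
move=> mf /integrableP[_ fin]; apply/integrableP; split.
  by apply/measurable_EFinP; exact: measurableT_comp.
rewrite (_ : (\int[P]_x _)%E = (\int[P]_x `|(f (Z 0%N x))%:E|)%E)//.
apply: (@ge0_integral_step i (fun z => `|(f z)%:E|%E)) => //.
by apply: measurableT_comp => //; exact/measurable_EFinP.
Qed.

Lemma expectation_step i (f : R * R -> R) : measurable_fun setT f ->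
  P.-integrable setT (EFin \o (f \o Z 0%N)) ->
  \int[P]_x f (Z i x) = \int[P]_x f (Z 0%N x).
Proof.
move=> mf f0.
have tr j : (\int[P]_x (f (Z j x))%:E = \int[pushforward P (Z j)]_z (f z)%:E)%E.
  rewrite integral_pushforward//; first exact/measurable_EFinP.
  exact: integrable_step.
rewrite /Rintegral !tr; congr fine.
by apply: eq_measure_integral => A mA _; exact: identZ.
Qed.

Hypothesis Z2 : (\int[P]_x (norm2 (Z 0%N x) ^+ 2)%:E < +oo)%E.

Lemma norm2_sqr (v : R * R) : norm2 v ^+ 2 = dot2 v v.
Proof. by rewrite sqr_sqrtr ?dot2_ge0. Qed.

Lemma measurable_dot2_self : measurable_fun setT (fun z : R * R => dot2 z z).
Proof.
by apply: measurable_funD; apply: measurable_funM; (exact: measurable_fst || exact: measurable_snd).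
Qed.

Let sqZ i x := dot2 (Z i x) (Z i x).

Lemma integrable_sqr_norm i : P.-integrable setT (EFin \o sqZ i).
Proof.
apply: (@integrable_step i (fun z => dot2 z z)); first exact: measurable_dot2_self.
apply/integrableP; split.
  by apply/measurable_EFinP; apply: measurableT_comp => //; exact: measurable_dot2_self.
apply: le_lt_trans Z2; rewrite le_eqVlt; apply/orP; left; apply/eqP.
by apply: eq_integral => x _ /=; rewrite ger0_norm ?dot2_ge0// norm2_sqr.
Qed.

Lemma cauchy_schwarz2 (u v : R * R) : dot2 u v ^+ 2 <= dot2 v v * dot2 u u.
Proof.
have -> : dot2 v v * dot2 u u = dot2 u v ^+ 2 + cross2 u v ^+ 2.
  by rewrite /dot2 /cross2; ring.
by rewrite lerDl sqr_ge0.
Qed.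

Lemma sq_integrable_dot2 i e : sq_integrable P (fun x => dot2 (Z i x) e).
Proof.
have m : measurable_fun setT (fun x => dot2 (Z i x) e) by exact: measurable_dot2.
split => //; apply: integrable_le (integrable_scaler (dot2 e e) (integrable_sqr_norm i)) _.
  exact: measurable_funX.
by move=> x; rewrite ger0_norm ?sqr_ge0//; exact: cauchy_schwarz2.
Qed.

Lemma expectation_dot2 i e : \int[P]_x dot2 (Z i x) e = dot2 (mean2 P (Z 0%N)) e.
Proof.
rewrite (@expectation_step i (fun z => dot2 z e)); last 2 first.
- exact: (measurable_dot2 e (@measurable_id _ _ _)).
- exact: sq_integrable_integrable (sq_integrable_dot2 0 e).
have i1 : P.-integrable setT (EFin \o (fun x => (Z 0%N x).1)).
  have := sq_integrable_integrable (sq_integrable_dot2 0 (1, 0)).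
  by apply: eq_integrable => // x _ /=; rewrite /dot2 /= mulr1 mulr0 addr0.
have i2 : P.-integrable setT (EFin \o (fun x => (Z 0%N x).2)).
  have := sq_integrable_integrable (sq_integrable_dot2 0 (0, 1)).
  by apply: eq_integrable => // x _ /=; rewrite /dot2 /= mulr1 mulr0 add0r.
rewrite {2}/dot2 /= -/(Rintegral P setT (fun x => (Z 0%N x).1)).
rewrite -/(Rintegral P setT (fun x => (Z 0%N x).2)).
rewrite [in RHS]mulrC -RintegralZl//.
rewrite [X in _ + X]mulrC -RexpectationDZ//; last exact: integrable_scaler.
by apply: eq_Rintegral => x _; rewrite /dot2; ring.
Qed.

Lemma expectation_dot2_sqr_le i e : dot2 e e <= 2 ->
  \int[P]_x dot2 (Z i x) e ^+ 2 <= 2 * \int[P]_x sqZ 0 x.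
Proof.
move=> e2; rewrite (@expectation_step i (fun z => dot2 z e ^+ 2)); last 2 first.
- by apply: measurable_funX; exact: (measurable_dot2 e (@measurable_id _ _ _)).
- exact: (sq_integrable_dot2 0 e).2.
rewrite -RintegralZl//; last exact: integrable_sqr_norm.
apply: Rexpectation_le; first exact: (sq_integrable_dot2 0 e).2.
  exact: integrable_scaler (integrable_sqr_norm 0).
move=> x; apply: le_trans (cauchy_schwarz2 _ _) _.
by rewrite ler_wpM2r ?dot2_ge0.
Qed.

(* Bounds the contribution of [X ^+ 2 > b] for every projection [X] of a step on
   a vector [e] with [dot2 e e <= 2]. *)
Definition tail b := \int[P]_x (2 * Num.max (2 * sqZ 0 x - b) 0).

Lemma measurable_excess b (f : T -> R) : measurable_fun setT f ->
  measurable_fun setT (fun x => Num.max (f x - b) 0).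
Proof.
move=> mf; apply: measurable_maxr; last exact: measurable_cst.
by apply: measurable_funB => //; exact: measurable_cst.
Qed.

Lemma measurable_sqZ i : measurable_fun setT (sqZ i).
Proof. exact: (measurableT_comp measurable_dot2_self (mZ i)). Qed.

Lemma integrable_excess b c (f : T -> R) : 0 <= b -> 0 <= c ->
  measurable_fun setT f -> (forall x, 0 <= f x) ->
  P.-integrable setT (EFin \o f) ->
  P.-integrable setT (EFin \o (fun x => c * Num.max (f x - b) 0)).
Proof.
move=> b0 c0 mf f0 intf; apply: integrable_scaler.
apply: integrable_le intf _; first exact: measurable_excess.
move=> x; rewrite ger0_norm; last by rewrite le_max lexx orbT.
by rewrite ge_max f0 andbT gerBl.
Qed.

Lemma expectation_excess_le i e b : dot2 e e <= 2 -> 0 <= b ->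
  \int[P]_x (2 * Num.max (dot2 (Z i x) e ^+ 2 - b) 0) <= tail b.
Proof.
move=> e2 b0.
have mX2 : measurable_fun setT (fun x => dot2 (Z 0%N x) e ^+ 2).
  by apply: measurable_funX; exact: measurable_dot2.
have intX := integrable_excess b0 (ler0n R 2) mX2 (fun x => sqr_ge0 _)
  (sq_integrable_dot2 0 e).2.
rewrite (@expectation_step i (fun z => 2 * Num.max (dot2 z e ^+ 2 - b) 0)); last 2 first.
- apply: measurable_funM; first exact: measurable_cst.
  apply: measurable_maxr; last exact: measurable_cst.
  apply: measurable_funB; last exact: measurable_cst.
  by apply: measurable_funX; exact: (measurable_dot2 e (@measurable_id _ _ _)).
- exact: intX.
apply: Rexpectation_le.
- exact: intX.
- apply: integrable_excess => //.
  + by apply: measurable_funM; [exact: measurable_cst | exact: measurable_sqZ].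
  + by move=> x; rewrite mulr_ge0// dot2_ge0.
  + exact: integrable_scaler (integrable_sqr_norm 0).
move=> x; rewrite ler_pM2l// ge_max le_max le_max lexx orbT andbT lerD2r.
apply/orP; left; apply: le_trans (cauchy_schwarz2 _ _) _.
by rewrite ler_wpM2r ?dot2_ge0.
Qed.

Lemma tail_small (eps : R) : 0 < eps -> exists2 b, 0 <= b & tail b <= eps.
Proof.
move=> eps0.
pose f_ (k : nat) x := (2 * Num.max (2 * sqZ 0 x - k%:R) 0)%:E : \bar R.
have ig : P.-integrable setT (EFin \o (fun x => 4 * sqZ 0 x)).
  exact: integrable_scaler (integrable_sqr_norm 0).
have [] := @dominated_convergence _ T R P setT measurableT f_ (cst 0%E)
  (EFin \o (fun x => 4 * sqZ 0 x)).
- move=> k; apply/measurable_EFinP; apply: measurable_funM; first exact: measurable_cst.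
  apply: measurable_excess; apply: measurable_funM; first exact: measurable_cst.
  exact: measurable_sqZ.
- exact: measurable_cst.
- apply: aeW => x _; apply: cvg_near_cst.
  near=> k; rewrite /f_ (max_idPr _) ?mulr0// subr_le0.
  by near: k; exact: nbhs_infty_ger.
- exact: ig.
- apply: aeW => x k _; have z0 : 0 <= sqZ 0 x := dot2_ge0 _.
  rewrite /f_ /= lee_fin ger0_norm; last by rewrite mulr_ge0// le_max lexx orbT.
  rewrite (_ : 4 * _ = 2 * (2 * sqZ 0 x)); last by ring.
  by rewrite ler_pM2l// ge_max gerBl ler0n mulr_ge0.
move=> _ _; rewrite integral0 => /fine_cvgP[_] /cvgrPdist_le /(_ _ eps0)[k _ /(_ k (leqnn k))].
rewrite /= sub0r normrN => tailk; exists k%:R; first exact: ler0n.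
exact: le_trans (ler_norm _) tailk.
Unshelve. all: by end_near.
Qed.

End StepLaw.

Lemma sqr_add_le {R : realDomainType} (x y : R) : (x + y) ^+ 2 <= 2 * (x ^+ 2 + y ^+ 2).
Proof. by have := sqr_ge0 (x - y); nra. Qed.

Lemma sqr_sum_le {R : realDomainType} (F : nat -> R) n :
  (\sum_(i < n) F i) ^+ 2 <= n%:R * \sum_(i < n) F i ^+ 2.
Proof.
elim: n => [|n IH]; first by rewrite !big_ord0 expr0n mulr0.
rewrite !big_ord_recr/=; set S := \sum_(i < n) F i in IH *.
set Q := \sum_(i < n) F i ^+ 2 in IH *; set y := F n.
have : 0 <= Q - 2 * y * S + n%:R * y ^+ 2.
  rewrite (_ : _ + _ = \sum_(i < n) (F i - y) ^+ 2); last first.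
    transitivity (\sum_(i < n) (F i ^+ 2 + - (2 * y) * F i + y ^+ 2)).
      rewrite !big_split /= -mulr_sumr sumr_const card_ord -/S -/Q; ring.
    by apply: eq_bigr => i _; ring.
  by apply: sumr_ge0 => i _; exact: sqr_ge0.
by rewrite -natr1; lra.
Qed.

Section Expectation.
Context {d} {T : measurableType d} {R : realType} (P : probability T R).

Lemma Rexpectation_le_nomeas (f g : T -> R) : (forall x, 0 <= f x) ->
  (forall x, f x <= g x) -> (\int[P]_x (g x)%:E < +oo)%E ->
  \int[P]_x f x <= \int[P]_x g x.
Proof.
move=> f0 fg goo.
have le : (\int[P]_x (f x)%:E <= \int[P]_x (g x)%:E)%E.
  by apply: ge0_le_integral_nomeas => x; rewrite lee_fin.
have g0 x : 0 <= g x := le_trans (f0 x) (fg x).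
apply: fine_le => //; rewrite ge0_fin_numE ?integral_ge0//.
- by apply: le_lt_trans le goo.
- by move=> x _; rewrite lee_fin.
- by move=> x _; rewrite lee_fin.
Qed.

Lemma integrable_EFin_lty (f : T -> R) : P.-integrable setT (EFin \o f) ->
  (\int[P]_x (f x)%:E < +oo)%E.
Proof. by move=> /integrable_lty; apply. Qed.

Lemma expectation_sqr_add_le (f g : T -> R) : sq_integrable P f -> sq_integrable P g ->
  \int[P]_x (f x + g x) ^+ 2 <= 2 * (\int[P]_x f x ^+ 2 + \int[P]_x g x ^+ 2).
Proof.
move=> f2 g2; rewrite -RintegralD//; [|exact: f2.2|exact: g2.2].
have i2 := integrable_addr f2.2 g2.2.
rewrite -RintegralZl//; apply: Rexpectation_le.
- exact: (sq_integrableD f2 g2).2.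
- exact: integrable_scaler i2.
- by move=> x; exact: sqr_add_le.
Qed.

Lemma expectation_sqrZ (k : R) (f : T -> R) : sq_integrable P f ->
  \int[P]_x (k * f x) ^+ 2 = k ^+ 2 * \int[P]_x f x ^+ 2.
Proof.
move=> f2; rewrite -RintegralZl//; last exact: f2.2.
by apply: eq_Rintegral => x _; rewrite exprMn.
Qed.

Lemma expectation_sqr_sum_le (F : nat -> T -> R) (V : R) n :
  (forall i, sq_integrable P (F i)) -> (forall i, \int[P]_x F i x ^+ 2 <= V) ->
  \int[P]_x (\sum_(i < n) F i x) ^+ 2 <= n%:R ^+ 2 * V.
Proof.
move=> F2 FV.
have iS k : P.-integrable setT (EFin \o (fun x => \sum_(i < k) F i x ^+ 2)).
  elim: k => [|k IH].
    have := (sq_integrable_cst P 0).2; apply: eq_integrable => // x _ /=.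
    by rewrite big_ord0 expr0n.
  have := integrable_addr IH (F2 k).2; apply: eq_integrable => // x _ /=.
  by rewrite big_ord_recr.
apply: (@le_trans _ _ (\int[P]_x (n%:R * \sum_(i < n) F i x ^+ 2))).
  apply: Rexpectation_le.
  - exact: (sq_integrable_sum n F2).2.
  - exact: integrable_scaler.
  - by move=> x; exact: (@sqr_sum_le _ (fun i => F i x)).
rewrite RintegralZl//.
rewrite expr2 -mulrA ler_wpM2l//.
elim: n => [|n IH].
  under eq_Rintegral do rewrite big_ord0.
  by rewrite Rintegral_cst// !mul0r.
under eq_Rintegral do rewrite big_ord_recr/=.
rewrite RintegralD//; [|exact: iS|exact: (F2 n).2].
by rewrite -natr1 mulrDl mul1r lerD.
Qed.

End Expectation.

Section HullError.
Context {d} {T : measurableType d} {R : realType} (P : probability T R).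
Variable Z : nat -> T -> R * R.
Hypothesis mZ : forall i, measurable_fun setT (Z i).
Hypothesis indepZ : independent_rvecs P Z.
Hypothesis identZ : identically_distributed P Z.
Hypothesis Z2 : (\int[P]_x (norm2 (Z 0%N x) ^+ 2)%:E < +oo)%E.
Let mu := mean2 P (Z 0%N).
Let V := 2 * \int[P]_x dot2 (Z 0%N x) (Z 0%N x).
Let X2 := sq_integrable_dot2 mZ identZ Z2.

Definition moment_bound (n : nat) (A b m : R) :=
  2 * A ^+ 2 + 2 * n%:R * (tail P Z b + 2 * b / (A * m) * V).

Lemma overshoot_sq_integrable e n :
  sq_integrable P (overshoot (fun i x => dot2 (Z i x) e) n).
Proof. by apply: sq_integrableD; exact: lindley_sq_integrable. Qed.

Lemma overshoot_second_moment e n (A b m : R) : dot2 e e <= 2 -> 0 < m ->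
  m <= dot2 mu e -> 0 < A -> 0 <= b -> 8 * b <= A ^+ 2 ->
  \int[P]_x overshoot (fun i x => dot2 (Z i x) e) n x ^+ 2 <=
  4 * moment_bound n A b m.
Proof.
move=> e2 m0 me A0 b0 bA.
have lin s : uniq s -> size s = n ->
    \int[P]_x lindley (fun i x => dot2 (Z i x) e) s x ^+ 2 <= moment_bound n A b m.
  move=> us <-; apply: lindley_second_moment => //.
  - by move=> i; rewrite expectation_dot2.
  - by move=> i; exact: expectation_dot2_sqr_le.
  - by move=> i; exact: expectation_excess_le.
have l1 := lin (rev (iota 0 n)); have l2 := lin (iota 0 n).
rewrite rev_uniq iota_uniq size_rev size_iota in l1 l2.
have W2 s := lindley_sq_integrable (fun i => X2 i e) s.
apply: le_trans (expectation_sqr_add_le (W2 _) (W2 _)) _.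
by have := l1 erefl erefl; have := l2 erefl erefl; lra.
Qed.

Variables (u : R * R) (m : R).
Hypotheses (u1 : dot2 u u = 1) (m0 : 0 < m).
Hypotheses (mu_u : dot2 mu u = m) (mu_uperp : dot2 mu (- u.2, u.1) = 0).

Lemma hull_error_sq_integrable t n : sq_integrable P (hull_error Z u t n).
Proof.
have S2 : sq_integrable P (fun x => \sum_(i < n) dot2 (Z i x) u).
  exact: (@sq_integrable_sum _ _ _ P (fun i x => dot2 (Z i x) u)).
apply: sq_integrableD; last exact: overshoot_sq_integrable.
apply: sq_integrableD; last exact: overshoot_sq_integrable.
apply: sq_integrableD; apply: sq_integrableZ; last exact: overshoot_sq_integrable.
apply: (sq_integrable_le _ S2); first by apply: measurableT_comp => //; case: S2.
by move=> x; rewrite normr_id.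
Qed.

Lemma hull_error_second_moment n (t A b : R) : 0 < t <= 1 ->
  0 < A -> 0 <= b -> 8 * b <= A ^+ 2 ->
  \int[P]_x hull_error Z u t n x ^+ 2 <=
  16 * t ^+ 4 * n%:R ^+ 2 * V + 96 * moment_bound n A b (t * m).
Proof.
move=> /andP[t0 t1] A0 b0 bA; have tm0 : 0 < t * m := mulr_gt0 t0 m0.
set el := (t * u.1 - u.2, t * u.2 + u.1).
set er := (t * u.1 + u.2, t * u.2 - u.1).
have tt1 : t ^+ 2 <= 1 by rewrite expr_le1// ltW.
have elE : dot2 el el = 1 + t ^+ 2.
  transitivity ((1 + t ^+ 2) * dot2 u u); first by rewrite /dot2 /=; ring.
  by rewrite u1 mulr1.
have erE : dot2 er er = 1 + t ^+ 2.
  transitivity ((1 + t ^+ 2) * dot2 u u); first by rewrite /dot2 /=; ring.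
  by rewrite u1 mulr1.
have mul : dot2 mu el = t * m.
  transitivity (t * dot2 mu u + dot2 mu (- u.2, u.1)).
    by rewrite /dot2 /=; ring.
  by rewrite mu_u mu_uperp addr0.
have mur : dot2 mu er = t * m.
  transitivity (t * dot2 mu u - dot2 mu (- u.2, u.1)).
    by rewrite /dot2 /=; ring.
  by rewrite mu_u mu_uperp subr0.
have o0 : \int[P]_x overshoot (fun i x => dot2 (Z i x) u) n x ^+ 2 <=
    4 * moment_bound n A b (t * m).
  apply: overshoot_second_moment => //; first by rewrite u1 ler1n.
  by rewrite mu_u ger_pMl.
have ol : \int[P]_x overshoot (fun i x => dot2 (Z i x) el) n x ^+ 2 <=
    4 * moment_bound n A b (t * m).
  by apply: overshoot_second_moment; rewrite ?mul ?elE//; lra.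
have or : \int[P]_x overshoot (fun i x => dot2 (Z i x) er) n x ^+ 2 <=
    4 * moment_bound n A b (t * m).
  by apply: overshoot_second_moment; rewrite ?mur ?erE//; lra.
have os e := overshoot_sq_integrable e n.
pose S x := \sum_(i < n) dot2 (Z i x) u.
have S2 : sq_integrable P S.
  exact: (@sq_integrable_sum _ _ _ P (fun i x => dot2 (Z i x) u)).
have aS2 : sq_integrable P (fun x => `|S x|).
  apply: (sq_integrable_le _ S2); first by apply: measurableT_comp => //; case: S2.
  by move=> x; rewrite normr_id.
have ES : \int[P]_x `|S x| ^+ 2 <= n%:R ^+ 2 * V.
  under eq_Rintegral do rewrite real_normK ?num_real//.
  apply: (@expectation_sqr_sum_le _ _ _ P (fun i x => dot2 (Z i x) u)) => // i.
  by apply: expectation_dot2_sqr_le => //; rewrite u1 ler1n.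
have a2 := sq_integrableZ (2 * t ^+ 2) aS2.
have b2 := sq_integrableZ 2 (os u).
have := expectation_sqr_add_le (sq_integrableD a2 b2) (sq_integrableD (os el) (os er)).
under eq_Rintegral do rewrite addrA.
move=> h; apply: le_trans h _.
have h1 := expectation_sqr_add_le a2 b2.
have h2 := expectation_sqr_add_le (os el) (os er).
rewrite !expectation_sqrZ// in h1.
have t4 : (2 * t ^+ 2) ^+ 2 * \int[P]_x `|S x| ^+ 2 <= (2 * t ^+ 2) ^+ 2 * (n%:R ^+ 2 * V).
  by rewrite ler_wpM2l// sqr_ge0.
apply: (@le_trans _ _ (2 * (2 * ((2 * t ^+ 2) ^+ 2 * (n%:R ^+ 2 * V) +
  2 ^+ 2 * (4 * moment_bound n A b (t * m))) +
  2 * (4 * moment_bound n A b (t * m) + 4 * moment_bound n A b (t * m))))).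
  rewrite ler_pM2l// lerD//.
    by apply: le_trans h1 _; rewrite ler_pM2l// lerD// ler_wpM2l// sqr_ge0.
  by apply: le_trans h2 _; rewrite ler_pM2l// lerD.
by lra.
Qed.

End HullError.

(** * Centring and convergence *)

Section Centering.
Context {d} {T : measurableType d} {R : realType} (P : probability T R).

Lemma centered_second_moment_le (L S E : T -> R) (c : R) :
  (forall x, 0 <= L x) -> sq_integrable P S -> sq_integrable P E ->
  (forall x, 0 <= L x - S x <= E x) ->
  (\int[P]_x ((c * `|L x - fine (\int[P]_y (L y)%:E) - (S x - \int[P]_y S y)|) ^+ 2)%:E
   <= (c ^+ 2 * (4 * \int[P]_x E x ^+ 2))%:E)%E.
Proof.
move=> L0 S2 E2 LSE.
have iS := sq_integrable_integrable S2; have iE := sq_integrable_integrable E2.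
set EL := fine _; set ES := \int[P]_y S y; pose EE := \int[P]_x E x.
have E0 x : 0 <= E x by have /andP[] := LSE x; exact: le_trans.
have iSE : P.-integrable setT (EFin \o (fun x => S x + E x)) := integrable_addr iS iE.
have LleSE x : L x <= S x + E x by have /andP[_] := LSE x; rewrite lerBlDl.
have EL_le : EL <= ES + EE.
  rewrite /ES /EE -RintegralD//; apply: Rexpectation_le_nomeas => //.
  exact: integrable_EFin_lty.
have Smax_int : P.-integrable setT (EFin \o (fun x => Num.max (S x) 0)).
  apply: (@sq_integrable_integrable _ _ _ P); apply: (sq_integrable_le _ S2).
    by apply: measurable_maxr; [case: S2 | exact: measurable_cst].
  move=> x; rewrite ger0_norm; last by rewrite le_max lexx orbT.
  by rewrite ge_max ler_norm normr_ge0.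
have LS x : S x <= L x by have /andP[+ _] := LSE x; rewrite subr_ge0.
have EL_ge : ES <= EL.
  apply: (@le_trans _ _ (\int[P]_x Num.max (S x) 0)).
    by apply: Rexpectation_le => // x; rewrite le_max lexx.
  apply: Rexpectation_le_nomeas.
  - by move=> x; rewrite le_max lexx orbT.
  - by move=> x; rewrite ge_max LS L0.
  - apply: le_lt_trans (integrable_EFin_lty iSE).
    by apply: ge0_le_integral_nomeas => x; rewrite lee_fin.
have EE0 : 0 <= EE by apply: Rintegral_ge0 => x _.
have bound x : (c * `|L x - EL - (S x - ES)|) ^+ 2 <= c ^+ 2 * (2 * (E x ^+ 2 + EE ^+ 2)).
  rewrite exprMn ler_wpM2l ?sqr_ge0// real_normK ?num_real//.
  apply: (@le_trans _ _ ((E x + EE) ^+ 2)); last exact: sqr_add_le.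
  rewrite -[leLHS]real_normK ?num_real// lerXn2r// ?nnegrE ?addr_ge0//.
  by rewrite ler_norml; have /andP[] := LSE x; lra.
have iE2 : P.-integrable setT (EFin \o (fun x => E x ^+ 2)) := E2.2.
have icst k : P.-integrable setT (EFin \o (fun=> k)).
  exact: (finite_measure_integrable_cst P _ measurableT).
have iB : P.-integrable setT (EFin \o (fun x => c ^+ 2 * (2 * (E x ^+ 2 + EE ^+ 2)))).
  by do 2 apply: integrable_scaler; exact: integrable_addr.
apply: (@le_trans _ _ (\int[P]_x (c ^+ 2 * (2 * (E x ^+ 2 + EE ^+ 2)))%:E)%E).
  by apply: ge0_le_integral_nomeas => x; rewrite lee_fin ?sqr_ge0.
rewrite -(fineK (integrable_fin_num measurableT iB)) lee_fin.
rewrite -/(Rintegral P setT (fun x => c ^+ 2 * (2 * (E x ^+ 2 + EE ^+ 2)))).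
have P1 : fine (P setT) = 1 by rewrite probability_setT.
rewrite !RintegralZl//; last 2 first.
- exact: integrable_addr.
- by apply: integrable_scaler; exact: integrable_addr.
rewrite RintegralD// Rintegral_cst//= P1 mulr1 ler_wpM2l ?sqr_ge0//.
(* Jensen: [(E X) ^+ 2 <= E (X ^+ 2)] *)
suff : EE ^+ 2 <= \int[P]_x E x ^+ 2 by lra.
have : 0 <= \int[P]_x (E x ^+ 2 + (- 2 * EE) * E x + EE ^+ 2).
  apply: Rintegral_ge0 => x _; rewrite (_ : _ + _ = (E x - EE) ^+ 2) ?sqr_ge0//; ring.
rewrite RintegralD//; last exact: integrable_addr iE2 (integrable_scaler _ iE).
rewrite RexpectationDZ// Rintegral_cst//= P1 mulr1 -/EE; lra.
Qed.

End Centering.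

Lemma rate_small {R : realFieldType} (V m eps b eta tau r : R) :
  0 <= V -> 0 < m -> 0 < eps -> 0 <= b -> 0 < eta <= 1 -> tau <= eps / 3 / 768 ->
  eta * (64 * V + 768) <= eps / 3 -> 0 < r ->
  3 * (1536 * b * V) / (eta ^+ 2 * m * eps) <= r ->
  (r ^+ 2)^-1 ^+ 2 * (4 * (16 * (eta / r) ^+ 4 * (r ^+ 4) ^+ 2 * V +
    96 * (2 * (eta * r ^+ 2) ^+ 2 + 2 * r ^+ 4 *
      (tau + 2 * b / (eta * r ^+ 2 * (eta / r * m)) * V)))) <= eps.
Proof.
move=> V0 m0 eps0 b0 /andP[eta0 eta1] taub etab r0 rb.
have -> : (r ^+ 2)^-1 ^+ 2 * (4 * (16 * (eta / r) ^+ 4 * (r ^+ 4) ^+ 2 * V +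
    96 * (2 * (eta * r ^+ 2) ^+ 2 + 2 * r ^+ 4 *
      (tau + 2 * b / (eta * r ^+ 2 * (eta / r * m)) * V)))) =
    eta ^+ 2 * (64 * eta ^+ 2 * V + 768) + 768 * tau +
    1536 * b * V / (eta ^+ 2 * m) / r.
  by field; rewrite !gt_eqF.
have e2 : eta ^+ 2 <= eta by rewrite expr2 ger_pMl.
have t1 : eta ^+ 2 * (64 * eta ^+ 2 * V + 768) <= eta * (64 * V + 768).
  have q0 := sqr_ge0 eta.
  have qqV : eta ^+ 2 * eta ^+ 2 * V <= eta * V.
    by apply: (ler_wpM2r V0); nra.
  lra.
have t3 : 1536 * b * V / (eta ^+ 2 * m) / r <= eps / 3.
  rewrite ler_pdivrMr//.
  have -> : 1536 * b * V / (eta ^+ 2 * m) = eps / 3 * (3 * (1536 * b * V) / (eta ^+ 2 * m * eps)).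
    by field; rewrite !gt_eqF.
  by rewrite ler_pM2l// divr_gt0.
lra.
Qed.

Lemma ge0_cvge0 {R : realType} (f : nat -> \bar R) : (forall n, 0 <= f n)%E ->
  (forall eps : R, 0 < eps -> \forall n \near \oo, (f n <= eps%:E)%E) ->
  f @ \oo --> 0%E.
Proof.
move=> f0 feps; apply/fine_cvgP; split.
  apply: filterS (feps 1 ltr01) => n fn.
  by rewrite ge0_fin_numE// (le_lt_trans fn)// ltry.
apply/cvgrPdist_le => eps eps0; apply: filterS (feps eps eps0) => n fn.
rewrite sub0r normrN /= ger0_norm ?fine_ge0// -lee_fin fineK//.
by rewrite ge0_fin_numE// (le_lt_trans fn)// ltry.
Qed.

Theorem theorem1p3 (d : measure_display) (T : measurableType d) (R : realType)
    (P : probability T R) (Z : nat -> T -> R * R) :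
  (forall i, measurable_fun setT (Z i)) ->
  independent_rvecs P Z ->
  identically_distributed P Z ->
  (\int[P]_x (norm2 (Z 0%N x) ^+ 2)%:E < +oo)%E ->
  norm2 (mean2 P (Z 0%N)) != 0 ->
  let mu := mean2 P (Z 0%N) in
  ((fun n : nat =>
     (\int[P]_x ((((Num.sqrt (n%:R : R))^-1 *
        `| hull_len Z n x - fine (\int[P]_y (hull_len Z n y)%:E)
           - \sum_(i < n) 2 * dot2 (sub2 (Z i x) mu) mu / norm2 mu |) ^+ 2)%:E))%E)
    @ \oo --> 0%E)%E.
Proof.
move=> mZ indepZ identZ Z2 mu_neq0 mu.
pose m := norm2 mu.
have m0 : 0 < m by rewrite lt_neqAle eq_sym mu_neq0 sqrtr_ge0.
have m2 : dot2 mu mu = m ^+ 2 by rewrite norm2_sqr.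
pose u := scale2 m^-1 mu.
have mN0 : m != 0 by rewrite gt_eqF.
have u1 : dot2 u u = 1.
  transitivity (m^-1 ^+ 2 * dot2 mu mu); first by rewrite /u /scale2 /dot2 /=; ring.
  by rewrite m2 -exprMn mulVf// expr1n.
have mu_u : dot2 mu u = m.
  transitivity (m^-1 * dot2 mu mu); first by rewrite /u /scale2 /dot2 /=; ring.
  by rewrite m2 expr2 mulKf.
have mu_uperp : dot2 mu (- u.2, u.1) = 0 by rewrite /u /scale2 /dot2 /=; ring.
pose V := 2 * \int[P]_x dot2 (Z 0%N x) (Z 0%N x).
have V0 : 0 <= V by rewrite mulr_ge0// Rintegral_ge0// => x _; exact: dot2_ge0.
have X2 i := sq_integrable_dot2 mZ identZ Z2 i u.
pose S n x := 2 * \sum_(i < n) dot2 (Z i x) u.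
have S2 n : sq_integrable P (S n).
  by apply: sq_integrableZ; exact: (@sq_integrable_sum _ _ _ P (fun i x => dot2 (Z i x) u)).
have ES n : \int[P]_x S n x = 2 * (n%:R * m).
  have iS k : P.-integrable setT (EFin \o (fun x => \sum_(i < k) dot2 (Z i x) u)).
    apply: sq_integrable_integrable.
    exact: (@sq_integrable_sum _ _ _ P (fun i x => dot2 (Z i x) u)).
  rewrite RintegralZl//; congr (_ * _); elim: n => [|n IH].
    under eq_Rintegral do rewrite big_ord0.
    by rewrite Rintegral_cst// !mul0r.
  under eq_Rintegral do rewrite big_ord_recr/=.
  rewrite RintegralD//; [|exact: iS|exact: sq_integrable_integrable].
  by rewrite IH expectation_dot2// -/mu mu_u -natr1 mulrDl mul1r.
have sumE n x : \sum_(i < n) 2 * dot2 (sub2 (Z i x) mu) mu / norm2 mu =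
    S n x - \int[P]_y S n y.
  rewrite ES /S !mulr_sumr.
  have -> : 2 * (n%:R * m) = \sum_(i < n) 2 * m by rewrite sumr_const card_ord; ring.
  rewrite -sumrB; apply: eq_bigr => i _; rewrite -/m dot2B m2.
  have -> : dot2 (Z i x) mu = m * dot2 (Z i x) u.
    transitivity (m / m * dot2 (Z i x) mu); first by rewrite divff// mul1r.
    by rewrite /u /scale2 /dot2 /=; ring.
  by field.
apply: ge0_cvge0 => [n|eps eps0].
  by apply: integral_ge0 => x _; rewrite lee_fin sqr_ge0.
have [b b0 taub] := tail_small mZ identZ Z2 (divr_gt0 (divr_gt0 eps0 (ltr0n R 3)) (ltr0n R 768)).
pose eta := Num.min 1 (eps / 3 / (64 * V + 768)).
have D0 : 0 < 64 * V + 768 by lra.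
have eta0 : 0 < eta by rewrite lt_min ltr01/= !divr_gt0.
have eta1 : eta <= 1 by rewrite ge_min lexx.
have etab : eta * (64 * V + 768) <= eps / 3.
  by rewrite -ler_pdivlMr// ge_min lexx orbT.
pose K := 1 + 3 * (1536 * b * V) / (eta ^+ 2 * m * eps) + 8 * b / eta ^+ 2.
have K1 : 0 <= 3 * (1536 * b * V) / (eta ^+ 2 * m * eps).
  have bV0 := mulr_ge0 b0 V0; apply: divr_ge0; first lra.
  exact: mulr_ge0 (mulr_ge0 (sqr_ge0 _) (ltW m0)) (ltW eps0).
have K2 : 0 <= 8 * b / eta ^+ 2 by apply: divr_ge0; [lra | exact: sqr_ge0].
near=> n.
pose r : R := Num.sqrt (Num.sqrt n%:R).
have r2 : r ^+ 2 = Num.sqrt n%:R by rewrite sqr_sqrtr// sqrtr_ge0.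
have r4 : r ^+ 4 = n%:R by rewrite (exprM r 2 2) r2 sqr_sqrtr.
have rK : K <= r.
  have K0 : 0 <= K by rewrite /K; lra.
  rewrite leNgt; apply/negP => rK.
  have : r ^+ 4 < K ^+ 4 by rewrite ltrXn2r// ?sqrtr_ge0.
  rewrite r4 ltNge => /negP; apply.
  by near: n; exact: nbhs_infty_ger.
have r1 : 1 <= r by rewrite /K in rK; lra.
have r0 : 0 < r by lra.
have rr4 : r <= r ^+ 4 by rewrite -[leLHS]expr1 ler_weXn2l.
have t01 : 0 < eta / r <= 1.
  by rewrite divr_gt0//= ler_pdivrMr// mul1r (le_trans eta1).
have A0 : 0 < eta * r ^+ 2 by rewrite mulr_gt0// exprn_gt0.
have bA : 8 * b <= (eta * r ^+ 2) ^+ 2.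
  have -> : (eta * r ^+ 2) ^+ 2 = r ^+ 4 * eta ^+ 2 by ring.
  rewrite -ler_pdivrMr ?exprn_gt0//; apply: le_trans rr4.
  by rewrite /K in rK; lra.
have t01' : 0 <= eta / r <= 1 by case/andP: t01 => /ltW -> ->.
apply: (@le_trans _ _ (((Num.sqrt n%:R)^-1 ^+ 2 * (4 * \int[P]_x hull_error Z u (eta / r) n x ^+ 2))%:E)).
  under eq_integral do rewrite sumE.
  apply: centered_second_moment_le => //.
  - move=> x; apply: sumr_ge0 => p _; apply: sumr_ge0 => q _; exact: sqrtr_ge0.
  - exact: hull_error_sq_integrable.
  - by move=> x; exact: hull_len_bounds.
rewrite lee_fin -r2.
have := hull_error_second_moment mZ indepZ identZ Z2 u1 m0 mu_u mu_uperp n t01 A0 b0 bA.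
rewrite /moment_bound -/V -r4 => he.
apply: le_trans (rate_small V0 m0 eps0 b0 _ taub etab r0 _).
- by rewrite ler_wpM2l ?sqr_ge0// ler_wpM2l// (le_trans he).
- by rewrite eta0.
- by rewrite /K in rK; lra.
Unshelve. all: by end_near.
Qed.
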